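(* Let $\mathcal{C}$ be a semi-abelian category satisfying condition (UA), and let $B$ be an object of $\mathcal{C}$. Let $f\colon (\partial\colon X\to B,\xi)\to(\partial'\colon Y\to B,\xi')$ be an extension (that is, a regular epimorphism) in the category $\mathbf{PXMod}_B(\mathcal{C})$ of internal precrossed $B$-modules in $\mathcal{C}$. Then $f$ is $\mathbf{XMod}_B(\mathcal{C})$-central if and only if the Peiffer commutator of $K[f]$ and $X$ (as precrossed submodules of $X$) is trivial: $$\langle K[f],X\rangle=0.$$
   Context: Internal actions. Let $\mathcal{C}$ be a semi-abelian category. For objects $B,X$, $B\flat X$ denotes the kernel of $[1,0]\colon B+X\to B$; $B\flat(-)$ is the functor part of a monad on $\mathcal{C}$, and an internal $B$-action on $X$ is an algebra $\xi\colon B\flat X\to X$ of this monad. For $u\colon A\to B$, $v\colon X\to Y$, $u\flat v\colon A\flat X\to B\flat Y$ is the restriction of $u+v$. Internal $B$-actions are equivalent to points over $B$ (split epimorphisms onto $B$ with a chosen section): $\xi$ corresponds to $p_B\colon X\rtimes_\xi B\to B$ with section $i_B$ and kernel $j_X\colon X\to X\rtimes_\xi B$, where $j_X\xi=[i_B,j_X]\ker[1,0]$. The pullback action of $\xi$ along $u\colon A\to B$ is $u^*(\xi)=\xi\cdot(u\flat 1_X)$. The conjugation action $\chi\colon B\flat B\to B$ is the restriction of $[1,1]\colon B+B\to B$ to $B\flat B$ (similarly for $X$). Condition (UA): for every cospan $f\colon A\to B$, $g\colon C\to B$ in $\mathcal{C}$ that is jointly extremal epimorphic, and for all internal actions $\xi_1\colon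 A\flat X\to X$, $\xi_2\colon C\flat X\to X$, $\xi_3,\xi_4\colon B\flat X\to X$ on a same object $X$ with $\xi_3(f\flat 1)=\xi_1=\xi_4(f\flat 1)$ and $\xi_3(g\flat 1)=\xi_2=\xi_4(g\flat 1)$, one has $\xi_3=\xi_4$. It is known that (UA) implies the ''Smith is Huq'' condition (SH) (two equivalence relations on an object centralize each other in the Smith–Pedicchio sense if and only if the corresponding normal subobjects commute in the sense of Huq). Precrossed and crossed modules. A precrossed $B$-module in $\mathcal{C}$ is a pair $(\partial\colon X\to B,\xi)$ with $\xi\colon B\flat X\to X$ an internal action and $\partial\xi=\chi(1\flat\partial)$. A morphism $(\partial,\xi)\to(\partial',\xi')$ is a morphism $f\colon X\to Y$ with $\partial'f=\partial$ and $f\xi=\xi'(1\flat f)$. These form the category $\mathbf{PXMod}_B(\mathcal{C})$, equivalent to the category $\mathbf{RG}_B(\mathcal{C})$ of internal reflexive graphs $(d,c\colon X_1\to B, e\colon B\to X_1)$, $de=1=ce$, over the fixed object $B$: a reflexive graph is sent to $X=K[d]$, $\partial=c\cdot\ker(d)$, with the action corresponding to the point $(d,e)$; so $X_1=X\rtimes_\xi B$. Under (SH), $(\partial,\xi)$ is a crossed module if and only if $\xi(\partial\flat 1)=\chi\colon X\flat X\to X$; equivalently, if and only if the corresponding reflexive graph is an internal groupoid. Crossed modules over $B$ form a full reflective (Birkhoff) subcategory $\mathbf{XMod}_B(\mathcal{C})$, with reflector $G\colon\mathbf{PXMod}_B(\mathcal{C})\to\mathbf{XMod}_B(\mathcal{C})$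 and unit $\eta$. The category $\mathbf{PXMod}_B(\mathcal{C})$ is quasi-pointed with initial object $0\to B$; regular epimorphisms are those morphisms whose underlying morphism in $\mathcal{C}$ is a regular epimorphism; the kernel $K[f]$ of $f\colon X\to Y$ (the pullback of the initial object along $f$) has as underlying object the kernel of $f$ in $\mathcal{C}$, with structure morphism $0\colon K[f]\to B$. Peiffer commutator. Let $(\partial\colon X\to B,\xi)$, $(\partial'\colon Y\to B,\xi')$ be precrossed $B$-modules with corresponding reflexive graphs $X_1,Y_1$. Put $X\rtimes Y=X\rtimes_{\partial'^*\xi}Y$, with $j_X\colon X\to X\rtimes Y$, $i_Y\colon Y\to X\rtimes Y$, and the precrossed $B$-module structure that is the normalization of the reflexive graph $X_1\times_BY_1$ (pullback of $d_X$ and $c_Y$, with domain $d_Yp_2$, codomain $c_Xp_1$ and unit $(e_X,e_Y)$); symmetrically $Y\rtimes X=Y\rtimes_{\partial^*\xi'}X$ with $j_Y$, $i_X$. Then $j_X,i_Y,i_X,j_Y$ are morphisms of precrossed modules. Let $X+_{\mathsf{PX}}Y$ be the coproduct in $\mathbf{PXMod}_B(\mathcal{C})$. The Peiffer product $X\bowtie Y$ is the pushout in $\mathbf{PXMod}_B(\mathcal{C})$ of $[j_X,i_Y]\colon X+_{\mathsf{PX}}Y\to X\rtimes Y$ and $[i_X,j_Y]\colon X+_{\mathsf{PX}}Y\to Y\rtimes X$, and $\Sigma\colon X+_{\mathsf{PX}}Y\to X\bowtie Y$ is the diagonal of this pushout. If $m\colon X\to A$, $n\colon Y\to A$ are precrossed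 $B$-submodules (monomorphisms in $\mathbf{PXMod}_B(\mathcal{C})$) of $A$, the Peiffer commutator $\langle X,Y\rangle$ is the subobject of $A$ given by the regular image of the kernel of $\Sigma$ along $[m,n]\colon X+_{\mathsf{PX}}Y\to A$. In $\langle K[f],X\rangle$ the ambient object is $A=X$, with $m=\ker(f)$ and $n=1_X$. Central extensions. An extension $f\colon X\to Y$ in $\mathbf{PXMod}_B(\mathcal{C})$ is trivial if the naturality square $\eta_Y f=G(f)\eta_X$ is a pullback. It is $\mathbf{XMod}_B(\mathcal{C})$-central if there is a regular epimorphism $p\colon Z\to Y$ in $\mathbf{PXMod}_B(\mathcal{C})$ such that the pullback $Z\times_YX\to Z$ of $f$ along $p$ is a trivial extension. *)

(* Defs.v *)
(* Morphisms are compared with Leibniz equality.  Classical axioms supply unique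
   choice, to name the morphisms given by universal properties, and proof
   irrelevance, for equality of morphisms of precrossed modules. *)
From Stdlib Require Import ClassicalEpsilon.

Set Implicit Arguments.
Unset Strict Implicit.
Unset Printing Implicit Defensive.

Record Category := {
  Ob :> Type;
  Hom : Ob -> Ob -> Type;
  idm : forall A, Hom A A;
  compose : forall A B D, Hom B D -> Hom A B -> Hom A D;
  comp_id_l : forall A B (f : Hom A B), compose (idm B) f = f;
  comp_id_r : forall A B (f : Hom A B), compose f (idm A) = f;
  comp_assoc : forall A B D E (h : Hom D E) (g : Hom B D) (f : Hom A B),
    compose h (compose g f) = compose (compose h g) f
}.

Arguments Hom {_} _ _.
Arguments idm {_} _.
Arguments compose {_ _ _ _} _ _.

Notation "A ~> B" := (Hom A B) (at level 90, right associativity).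
Notation "g ∘ f" := (compose g f) (at level 40, left associativity).

Section General.
Variable C : Category.

Definition IsMono (A B : C) (m : A ~> B) : Prop :=
  forall (T : C) (x y : T ~> A), m ∘ x = m ∘ y -> x = y.

Definition IsIso (A B : C) (f : A ~> B) : Prop :=
  exists g : B ~> A, g ∘ f = idm A /\ f ∘ g = idm B.

Definition IsInitial (I : C) : Prop :=
  forall A : C, exists! f : I ~> A, True.

Definition IsTerminal (I : C) : Prop :=
  forall A : C, exists! f : A ~> I, True.

Definition IsCoequalizer (A B Q : C) (a b : A ~> B) (q : B ~> Q) : Prop :=
  q ∘ a = q ∘ b /\
  forall (T : C) (t : B ~> T), t ∘ a = t ∘ b -> exists! u : Q ~> T, u ∘ q = t.

Definition IsRegularEpi (A B : C) (f : A ~> B) : Prop :=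
  exists (Z : C) (a b : Z ~> A), IsCoequalizer a b f.

(* [h] is the regular image of [g] *)
Definition IsImage (A B H : C) (g : A ~> B) (h : H ~> B) : Prop :=
  IsMono h /\ exists e : A ~> H, IsRegularEpi e /\ h ∘ e = g.

Definition IsPullback (A B D P : C) (f : A ~> D) (g : B ~> D)
    (p : P ~> A) (q : P ~> B) : Prop :=
  f ∘ p = g ∘ q /\
  forall (T : C) (x : T ~> A) (y : T ~> B), f ∘ x = g ∘ y ->
    exists! u : T ~> P, p ∘ u = x /\ q ∘ u = y.

Definition IsPushout (A B D Q : C) (f : D ~> A) (g : D ~> B)
    (p : A ~> Q) (q : B ~> Q) : Prop :=
  p ∘ f = q ∘ g /\
  forall (T : C) (x : A ~> T) (y : B ~> T), x ∘ f = y ∘ g ->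
    exists! u : Q ~> T, u ∘ p = x /\ u ∘ q = y.

Definition IsCoproduct (A B S : C) (i : A ~> S) (j : B ~> S) : Prop :=
  forall (T : C) (x : A ~> T) (y : B ~> T),
    exists! u : S ~> T, u ∘ i = x /\ u ∘ j = y.

Record Pullback (A B D : C) (f : A ~> D) (g : B ~> D) := {
  pb_ob : C;
  pb_fst : pb_ob ~> A;
  pb_snd : pb_ob ~> B;
  pb_isPullback : IsPullback f g pb_fst pb_snd
}.

Record Pushout (A B D : C) (f : D ~> A) (g : D ~> B) := {
  po_ob : C;
  po_fst : A ~> po_ob;
  po_snd : B ~> po_ob;
  po_isPushout : IsPushout f g po_fst po_snd
}.

Record Coproduct (A B : C) := {
  cp_ob : C;
  cp_inl : A ~> cp_ob;
  cp_inr : B ~> cp_ob;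
  cp_isCoproduct : IsCoproduct cp_inl cp_inr
}.

Definition pb_pair (A B D : C) (f : A ~> D) (g : B ~> D) (P : Pullback f g)
    (T : C) (x : T ~> A) (y : T ~> B) (e : f ∘ x = g ∘ y) : T ~> pb_ob P :=
  proj1_sig (constructive_definite_description _
    (proj2 (pb_isPullback P) T x y e)).

Definition cp_copair (A B : C) (S : Coproduct A B)
    (T : C) (x : A ~> T) (y : B ~> T) : cp_ob S ~> T :=
  proj1_sig (constructive_definite_description _ (@cp_isCoproduct A B S T x y)).

Definition IsJointlyExtremalEpi (A D B : C) (f : A ~> B) (g : D ~> B) : Prop :=
  forall (M : C) (m : M ~> B) (f' : A ~> M) (g' : D ~> M),
    IsMono m -> m ∘ f' = f -> m ∘ g' = g -> IsIso m.

(* The relation on [T ~> X] induced by a span [r1, r2 : R ~> X] *)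
Definition related (X R : C) (r1 r2 : R ~> X) (T : C) (x y : T ~> X) : Prop :=
  exists r : T ~> R, r1 ∘ r = x /\ r2 ∘ r = y.

(* Internal equivalence relation: [r1], [r2] jointly monic, and each
   [related r1 r2 T] an equivalence relation *)
Definition IsEquivRel (X R : C) (r1 r2 : R ~> X) : Prop :=
  (forall (T : C) (x y : T ~> R), r1 ∘ x = r1 ∘ y -> r2 ∘ x = r2 ∘ y -> x = y) /\
  (forall (T : C) (x : T ~> X), related r1 r2 x x) /\
  (forall (T : C) (x y : T ~> X), related r1 r2 x y -> related r1 r2 y x) /\
  (forall (T : C) (x y z : T ~> X),
     related r1 r2 x y -> related r1 r2 y z -> related r1 r2 x z).

(* In the next three definitions finite limits are assumed elsewhere
   (see [SemiAbelian]). *)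
Definition IsRegularCategory : Prop :=
  (forall (A B R : C) (f : A ~> B) (r1 r2 : R ~> A), IsPullback f f r1 r2 ->
     exists (Q : C) (q : A ~> Q), IsCoequalizer r1 r2 q) /\
  (forall (A B D P : C) (f : A ~> D) (g : B ~> D) (p : P ~> A) (q : P ~> B),
     IsPullback f g p q -> IsRegularEpi f -> IsRegularEpi q).

Definition IsBarrExact : Prop :=
  IsRegularCategory /\
  (forall (X R : C) (r1 r2 : R ~> X), IsEquivRel r1 r2 ->
     exists (Q : C) (q : X ~> Q), IsPullback q q r1 r2).

(* Bourn's definition: for every [u : A ~> B] the pullback functor [u^*] from
   points over [B] to points over [A] reflects isomorphisms.  Here [h] is a
   morphism of points over [B] and [k] its image under [u^*]. *)
Definition IsProtomodular : Prop :=
  forall (A B : C) (u : A ~> B)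
    (E : C) (p : E ~> B) (s : B ~> E) (E' : C) (p' : E' ~> B) (s' : B ~> E')
    (h : E ~> E')
    (P : C) (a : P ~> A) (b : P ~> E) (P' : C) (a' : P' ~> A) (b' : P' ~> E')
    (k : P ~> P'),
    p ∘ s = idm B -> p' ∘ s' = idm B -> p' ∘ h = p -> h ∘ s = s' ->
    IsPullback u p a b -> IsPullback u p' a' b' ->
    a' ∘ k = a -> b' ∘ k = h ∘ b ->
    IsIso k -> IsIso h.

End General.

(* The zero object, pullbacks and coproducts are chosen, so that kernels and
   the objects B♭X are functions of their arguments. *)
Record SemiAbelian (C : Category) := {
  zero : C;
  zero_initial : IsInitial zero;
  zero_terminal : IsTerminal zero;
  pullback : forall (A B D : C) (f : A ~> D) (g : B ~> D), Pullback f g;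
  coproduct : forall A B : C, Coproduct A B;
  semiabelian_exact : IsBarrExact C;
  semiabelian_protomodular : IsProtomodular C
}.

Section UniversalMorphisms.
Variable C : Category.

Lemma pb_pair_fst (A B D : C) (f : A ~> D) (g : B ~> D) (P : Pullback f g)
    (T : C) (x : T ~> A) (y : T ~> B) (e : f ∘ x = g ∘ y) :
  pb_fst P ∘ pb_pair P e = x.
Proof.
unfold pb_pair. destruct (constructive_definite_description _ _) as [u [e1 e2]].
exact e1.
Qed.

Lemma pb_pair_snd (A B D : C) (f : A ~> D) (g : B ~> D) (P : Pullback f g)
    (T : C) (x : T ~> A) (y : T ~> B) (e : f ∘ x = g ∘ y) :
  pb_snd P ∘ pb_pair P e = y.
Proof.
unfold pb_pair. destruct (constructive_definite_description _ _) as [u [e1 e2]].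
exact e2.
Qed.

Lemma pb_ext (A B D : C) (f : A ~> D) (g : B ~> D) (P : Pullback f g)
    (T : C) (x y : T ~> pb_ob P) :
  pb_fst P ∘ x = pb_fst P ∘ y -> pb_snd P ∘ x = pb_snd P ∘ y -> x = y.
Proof.
intros e1 e2. destruct (pb_isPullback P) as [e H].
destruct (H T (pb_fst P ∘ y) (pb_snd P ∘ y)) as [u [_ Hu]].
- rewrite !comp_assoc, e. reflexivity.
- rewrite <- (Hu x (conj e1 e2)). apply Hu. split; reflexivity.
Qed.

Lemma cp_copair_inl (A B : C) (S : Coproduct A B)
    (T : C) (x : A ~> T) (y : B ~> T) : cp_copair S x y ∘ cp_inl S = x.
Proof.
unfold cp_copair. destruct (constructive_definite_description _ _) as [u [e1 e2]].
exact e1.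
Qed.

Lemma cp_copair_inr (A B : C) (S : Coproduct A B)
    (T : C) (x : A ~> T) (y : B ~> T) : cp_copair S x y ∘ cp_inr S = y.
Proof.
unfold cp_copair. destruct (constructive_definite_description _ _) as [u [e1 e2]].
exact e2.
Qed.

Lemma cp_ext (A B : C) (S : Coproduct A B) (T : C) (x y : cp_ob S ~> T) :
  x ∘ cp_inl S = y ∘ cp_inl S -> x ∘ cp_inr S = y ∘ cp_inr S -> x = y.
Proof.
intros e1 e2.
destruct (@cp_isCoproduct _ _ _ S T (y ∘ cp_inl S) (y ∘ cp_inr S)) as [u [_ Hu]].
rewrite <- (Hu x (conj e1 e2)). apply Hu. split; reflexivity.
Qed.

End UniversalMorphisms.

Section InternalActions.
Variables (C : Category) (SA : SemiAbelian C).

Definition from_zero (A : C) : zero SA ~> A :=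
  proj1_sig (constructive_definite_description _ (zero_initial SA A)).

Definition to_zero (A : C) : A ~> zero SA :=
  proj1_sig (constructive_definite_description _ (zero_terminal SA A)).

Lemma from_zero_unique (A : C) (x y : zero SA ~> A) : x = y.
Proof.
destruct (zero_initial SA A) as [u [_ Hu]].
rewrite <- (Hu x I). apply Hu. exact I.
Qed.

Lemma to_zero_unique (A : C) (x y : A ~> zero SA) : x = y.
Proof.
destruct (zero_terminal SA A) as [u [_ Hu]].
rewrite <- (Hu x I). apply Hu. exact I.
Qed.

Definition zmor (A B : C) : A ~> B := from_zero B ∘ to_zero A.

Lemma comp_zmor (A B D : C) (f : B ~> D) : f ∘ zmor A B = zmor A D.
Proof.
unfold zmor. rewrite comp_assoc. f_equal. apply from_zero_unique.
Qed.

Lemma zmor_comp (A B D : C) (f : A ~> B) : zmor B D ∘ f = zmor A D.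
Proof.
unfold zmor. rewrite <- comp_assoc. f_equal. apply to_zero_unique.
Qed.

Definition IsKernel (K A B : C) (k : K ~> A) (f : A ~> B) : Prop :=
  f ∘ k = zmor K B /\
  forall (T : C) (t : T ~> A), f ∘ t = zmor T B -> exists! u : T ~> K, k ∘ u = t.

Definition ker (A B : C) (f : A ~> B) : C := pb_ob (pullback SA f (from_zero B)).

Definition kerm (A B : C) (f : A ~> B) : ker f ~> A :=
  pb_fst (pullback SA f (from_zero B)).

Definition ker_lift (A B : C) (f : A ~> B) (T : C) (t : T ~> A)
    (e : f ∘ t = zmor T B) : T ~> ker f :=
  pb_pair (pullback SA f (from_zero B)) e.

Lemma kerm_zero (A B : C) (f : A ~> B) : f ∘ kerm f = zmor (ker f) B.
Proof.
unfold zmor.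
etransitivity;
  [exact (proj1 (pb_isPullback (pullback SA f (from_zero B)))) |].
f_equal. apply to_zero_unique.
Qed.

Lemma kerm_mono (A B : C) (f : A ~> B) : IsMono (kerm f).
Proof.
intros T x y e. apply pb_ext; [exact e | apply to_zero_unique].
Qed.

Lemma kerm_lift (A B : C) (f : A ~> B) (T : C) (t : T ~> A)
    (e : f ∘ t = zmor T B) : kerm f ∘ ker_lift e = t.
Proof. apply pb_pair_fst. Qed.

Lemma kerm_isKernel (A B : C) (f : A ~> B) : IsKernel (kerm f) f.
Proof.
split; [apply kerm_zero |]. intros T t e. exists (ker_lift e). split.
- apply kerm_lift.
- intros u eu. apply kerm_mono. rewrite kerm_lift. symmetry. exact eu.
Qed.

Definition sum (A B : C) : C := cp_ob (coproduct SA A B).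
Definition inj1 (A B : C) : A ~> sum A B := cp_inl (coproduct SA A B).
Definition inj2 (A B : C) : B ~> sum A B := cp_inr (coproduct SA A B).
Definition copair (A B T : C) (x : A ~> T) (y : B ~> T) : sum A B ~> T :=
  cp_copair (coproduct SA A B) x y.
Definition sum_map (A A' B B' : C) (u : A ~> A') (v : B ~> B') :
  sum A B ~> sum A' B' := copair (inj1 A' B' ∘ u) (inj2 A' B' ∘ v).

Lemma copair_inj1 (A B T : C) (x : A ~> T) (y : B ~> T) :
  copair x y ∘ inj1 A B = x.
Proof. apply cp_copair_inl. Qed.

Lemma copair_inj2 (A B T : C) (x : A ~> T) (y : B ~> T) :
  copair x y ∘ inj2 A B = y.
Proof. apply cp_copair_inr. Qed.

Lemma sum_ext (A B T : C) (x y : sum A B ~> T) :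
  x ∘ inj1 A B = y ∘ inj1 A B -> x ∘ inj2 A B = y ∘ inj2 A B -> x = y.
Proof. apply cp_ext. Qed.

Lemma comp_copair (A B T T' : C) (h : T ~> T') (x : A ~> T) (y : B ~> T) :
  h ∘ copair x y = copair (h ∘ x) (h ∘ y).
Proof.
apply sum_ext; rewrite <- comp_assoc, ?copair_inj1, ?copair_inj2; reflexivity.
Qed.

Lemma copair_sum_map (A A' B B' T : C) (x : A' ~> T) (y : B' ~> T)
    (u : A ~> A') (v : B ~> B') :
  copair x y ∘ sum_map u v = copair (x ∘ u) (y ∘ v).
Proof.
unfold sum_map. rewrite comp_copair, !comp_assoc, copair_inj1, copair_inj2.
reflexivity.
Qed.

(* B♭X, the kernel of [1,0] : B + X ~> B *)
Definition flat (B X : C) : C := ker (copair (idm B) (zmor X B)).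

Definition flat_ker (B X : C) : flat B X ~> sum B X :=
  kerm (copair (idm B) (zmor X B)).

Lemma copair_zmor_flat_ker (B X D : C) (u : B ~> D) :
  copair u (zmor X D) ∘ flat_ker B X = zmor (flat B X) D.
Proof.
transitivity (u ∘ (copair (idm B) (zmor X B) ∘ flat_ker B X)).
- rewrite comp_assoc, comp_copair, comp_id_r, comp_zmor. reflexivity.
- transitivity (u ∘ zmor (flat B X) B);
    [f_equal; apply kerm_zero | apply comp_zmor].
Qed.

Lemma flat_map_subproof (A B X Y : C) (u : A ~> B) (v : X ~> Y) :
  copair (idm B) (zmor Y B) ∘ (sum_map u v ∘ flat_ker A X) = zmor (flat A X) B.
Proof.
rewrite comp_assoc, copair_sum_map, zmor_comp. apply copair_zmor_flat_ker.
Qed.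

(* u♭v *)
Definition flat_map (A B X Y : C) (u : A ~> B) (v : X ~> Y) :
  flat A X ~> flat B Y := ker_lift (flat_map_subproof u v).

Lemma flat_unit_subproof (B X : C) :
  copair (idm B) (zmor X B) ∘ inj2 B X = zmor X B.
Proof. apply copair_inj2. Qed.

Lemma flat_mult_subproof (B X : C) :
  copair (idm B) (zmor X B) ∘
    (copair (inj1 B X) (flat_ker B X) ∘ flat_ker B (flat B X)) =
  zmor (flat B (flat B X)) B.
Proof.
rewrite comp_assoc, comp_copair, copair_inj1, copair_zmor_flat_ker.
apply copair_zmor_flat_ker.
Qed.

(* Unit and multiplication of the monad B♭(-) *)
Definition flat_unit (B X : C) : X ~> flat B X :=
  ker_lift (flat_unit_subproof B X).

Definition flat_mult (B X : C) : flat B (flat B X) ~> flat B X :=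
  ker_lift (flat_mult_subproof B X).

Definition IsAction (B X : C) (xi : flat B X ~> X) : Prop :=
  xi ∘ flat_unit B X = idm X /\
  xi ∘ flat_mult B X = xi ∘ flat_map (idm B) xi.

Definition conj_action (X : C) : flat X X ~> X :=
  copair (idm X) (idm X) ∘ flat_ker X X.

(* [u^*(xi)] *)
Definition pullback_action (A B X : C) (u : A ~> B) (xi : flat B X ~> X) :
  flat A X ~> X := xi ∘ flat_map u (idm X).

(* The point [p], [s] with kernel [j] corresponds to the action [xi] *)
Definition IsSemidirect (B X E : C) (xi : flat B X ~> X)
    (p : E ~> B) (s : B ~> E) (j : X ~> E) : Prop :=
  p ∘ s = idm B /\ IsKernel j p /\ j ∘ xi = copair s j ∘ flat_ker B X.

Definition ConditionUA : Prop :=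
  forall (A D B : C) (f : A ~> B) (g : D ~> B), IsJointlyExtremalEpi f g ->
  forall (X : C) (xi1 : flat A X ~> X) (xi2 : flat D X ~> X)
    (xi3 xi4 : flat B X ~> X),
    IsAction xi1 -> IsAction xi2 -> IsAction xi3 -> IsAction xi4 ->
    xi3 ∘ flat_map f (idm X) = xi1 -> xi1 = xi4 ∘ flat_map f (idm X) ->
    xi3 ∘ flat_map g (idm X) = xi2 -> xi2 = xi4 ∘ flat_map g (idm X) ->
    xi3 = xi4.

Lemma flat_ker_mono (B X : C) : IsMono (flat_ker B X).
Proof. apply kerm_mono. Qed.

Lemma flat_ker_map (A B X Y : C) (u : A ~> B) (v : X ~> Y) :
  flat_ker B Y ∘ flat_map u v = sum_map u v ∘ flat_ker A X.
Proof. apply kerm_lift. Qed.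

Lemma flat_ker_unit (B X : C) : flat_ker B X ∘ flat_unit B X = inj2 B X.
Proof. apply kerm_lift. Qed.

Lemma flat_ker_mult (B X : C) :
  flat_ker B X ∘ flat_mult B X =
  copair (inj1 B X) (flat_ker B X) ∘ flat_ker B (flat B X).
Proof. apply kerm_lift. Qed.

Lemma flat_map_id (B X : C) : flat_map (idm B) (idm X) = idm (flat B X).
Proof.
apply flat_ker_mono. rewrite flat_ker_map, comp_id_r.
transitivity (idm (sum B X) ∘ flat_ker B X); [f_equal | apply comp_id_l].
apply sum_ext; unfold sum_map;
  rewrite ?copair_inj1, ?copair_inj2, comp_id_l, comp_id_r; reflexivity.
Qed.

Lemma flat_map_comp (A A' A'' X X' X'' : C) (u : A ~> A') (u' : A' ~> A'')
    (v : X ~> X') (v' : X' ~> X'') :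
  flat_map (u' ∘ u) (v' ∘ v) = flat_map u' v' ∘ flat_map u v.
Proof.
apply flat_ker_mono.
rewrite comp_assoc, !flat_ker_map, <- comp_assoc, flat_ker_map, comp_assoc.
f_equal. unfold sum_map at 1 2. rewrite copair_sum_map, <- !comp_assoc.
reflexivity.
Qed.

Lemma flat_map_zmor (A B X Y : C) (u : A ~> B) :
  flat_map u (zmor X Y) = zmor (flat A X) (flat B Y).
Proof.
apply flat_ker_mono. rewrite flat_ker_map, comp_zmor.
unfold sum_map. rewrite comp_zmor. apply copair_zmor_flat_ker.
Qed.

Lemma flat_unit_natural (B X Y : C) (v : X ~> Y) :
  flat_map (idm B) v ∘ flat_unit B X = flat_unit B Y ∘ v.
Proof.
apply flat_ker_mono.
rewrite !comp_assoc, flat_ker_map, <- comp_assoc, !flat_ker_unit.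
unfold sum_map. rewrite copair_inj2. reflexivity.
Qed.

Lemma flat_mult_natural (B X Y : C) (v : X ~> Y) :
  flat_map (idm B) v ∘ flat_mult B X =
  flat_mult B Y ∘ flat_map (idm B) (flat_map (idm B) v).
Proof.
apply flat_ker_mono.
rewrite !comp_assoc, flat_ker_map, flat_ker_mult, <- !comp_assoc,
  flat_ker_mult, flat_ker_map, !comp_assoc.
f_equal. rewrite copair_sum_map, comp_copair, flat_ker_map. f_equal.
unfold sum_map. apply copair_inj1.
Qed.

(* An equivariant mono into an action lifts the algebra laws *)
Lemma sub_isAction (B K X : C) (k : K ~> X) (xi : flat B X ~> X)
    (xik : flat B K ~> K) :
  IsMono k -> IsAction xi -> k ∘ xik = xi ∘ flat_map (idm B) k -> IsAction xik.
Proof.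
intros mk [H1 H2] e. split; apply mk; rewrite comp_assoc, e.
- rewrite <- comp_assoc, flat_unit_natural, comp_assoc, H1, comp_id_l, comp_id_r.
  reflexivity.
- rewrite <- comp_assoc, flat_mult_natural, comp_assoc, H2, comp_assoc, e.
  rewrite <- !comp_assoc, <- !flat_map_comp, !comp_id_l, e. reflexivity.
Qed.

End InternalActions.

Section PrecrossedModules.
Variables (C : Category) (SA : SemiAbelian C) (B : C).

Record PXObj := {
  px_ob :> C;
  px_bd : px_ob ~> B;
  px_act : flat SA B px_ob ~> px_ob;
  px_isAction : IsAction px_act;
  px_precrossed :
    px_bd ∘ px_act = conj_action SA B ∘ flat_map SA (idm B) px_bd
}.

Record PXHom (X Y : PXObj) := {
  px_hom :> X ~> Y;
  px_hom_bd : px_bd Y ∘ px_hom = px_bd X;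
  px_hom_act : px_hom ∘ px_act X = px_act Y ∘ flat_map SA (idm B) px_hom
}.

Lemma PXHom_eq (X Y : PXObj) (f g : PXHom X Y) :
  px_hom f = px_hom g -> f = g.
Proof.
destruct f as [f f1 f2], g as [g g1 g2]; simpl; intros e; subst g.
f_equal; apply proof_irrelevance.
Qed.

Definition px_id (X : PXObj) : PXHom X X.
Proof.
exists (idm X).
- apply comp_id_r.
- rewrite flat_map_id, comp_id_l, comp_id_r. reflexivity.
Defined.

Definition px_comp (X Y Z : PXObj) (g : PXHom Y Z) (f : PXHom X Y) : PXHom X Z.
Proof.
exists (px_hom g ∘ px_hom f).
- rewrite comp_assoc, !px_hom_bd. reflexivity.
- rewrite <- comp_assoc, px_hom_act, comp_assoc, px_hom_act, <- comp_assoc,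
    <- flat_map_comp, comp_id_l. reflexivity.
Defined.

Definition PXMod : Category.
Proof.
refine {| Ob := PXObj; Hom := PXHom; idm := px_id; compose := px_comp |};
  intros; apply PXHom_eq; simpl.
- apply comp_id_l.
- apply comp_id_r.
- apply comp_assoc.
Defined.

(* The Peiffer condition: under (SH), hence under (UA), it says that the
   corresponding reflexive graph is an internal groupoid. *)
Definition IsCrossed (X : PXMod) : Prop :=
  pullback_action (px_bd X) (px_act X) = conj_action SA X.

(* [eta] is the unit at [X] of the reflection onto crossed modules *)
Definition IsReflection (X GX : PXMod) (eta : X ~> GX) : Prop :=
  IsCrossed GX /\
  forall (Z : PXMod) (g : X ~> Z), IsCrossed Z -> exists! h : GX ~> Z, h ∘ eta = g.

(* The reflector enters through its values [GX], [GY], [Gf], which are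
   determined up to isomorphism. *)
Definition IsTrivialExtension (X Y : PXMod) (f : X ~> Y) : Prop :=
  IsRegularEpi f /\
  exists (GX GY : PXMod) (etaX : X ~> GX) (etaY : Y ~> GY) (Gf : GX ~> GY),
    IsReflection etaX /\ IsReflection etaY /\ IsPullback etaY Gf f etaX.

Definition IsCentralExtension (X Y : PXMod) (f : X ~> Y) : Prop :=
  exists (Z : PXMod) (p : Z ~> Y), IsRegularEpi p /\
  exists (P : PXMod) (q : P ~> Z) (r : P ~> X),
    IsPullback p f q r /\ IsTrivialExtension q.

Lemma px_zero_isAction : IsAction (to_zero SA (flat SA B (zero SA))).
Proof. split; apply to_zero_unique. Qed.

Lemma px_zero_precrossed :
  from_zero SA B ∘ to_zero SA (flat SA B (zero SA)) =
  conj_action SA B ∘ flat_map SA (idm B) (from_zero SA B).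
Proof.
unfold conj_action.
rewrite <- comp_assoc, flat_ker_map, comp_assoc, copair_sum_map, !comp_id_l.
rewrite (from_zero_unique (from_zero SA B) (zmor SA (zero SA) B)) at 2.
rewrite copair_zmor_flat_ker. reflexivity.
Qed.

Definition px_zero : PXMod := {|
  px_ob := zero SA;
  px_bd := from_zero SA B;
  px_act := to_zero SA (flat SA B (zero SA));
  px_isAction := px_zero_isAction;
  px_precrossed := px_zero_precrossed
|}.

Lemma px_zero_initial : IsInitial px_zero.
Proof.
intros X.
assert (H : from_zero SA X ∘ to_zero SA (flat SA B (zero SA)) =
            px_act X ∘ flat_map SA (idm B) (from_zero SA X)).
{ rewrite (from_zero_unique (from_zero SA X) (zmor SA (zero SA) X)) at 2.
  rewrite flat_map_zmor, comp_zmor. reflexivity. }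
exists (Build_PXHom (X := px_zero) (Y := X)
  (from_zero_unique (px_bd X ∘ from_zero SA X) (from_zero SA B)) H).
split; [exact I |]. intros g _. apply PXHom_eq. apply from_zero_unique.
Qed.

Section Kernel.
Variables (X Y : PXMod) (f : X ~> Y).

Lemma px_ker_act_subproof :
  px_hom f ∘ (px_act X ∘ flat_map SA (idm B) (kerm SA (px_hom f))) =
  zmor SA (flat SA B (ker SA (px_hom f))) Y.
Proof.
rewrite comp_assoc, px_hom_act, <- comp_assoc, <- flat_map_comp, kerm_zero.
rewrite flat_map_zmor, comp_zmor. reflexivity.
Qed.

Definition px_ker_act :
  flat SA B (ker SA (px_hom f)) ~> ker SA (px_hom f) :=
  ker_lift px_ker_act_subproof.

Lemma kerm_px_ker_act :
  kerm SA (px_hom f) ∘ px_ker_act =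
  px_act X ∘ flat_map SA (idm B) (kerm SA (px_hom f)).
Proof. apply kerm_lift. Qed.

Lemma px_ker_isAction : IsAction px_ker_act.
Proof.
exact (sub_isAction (kerm_mono (f:=px_hom f)) (px_isAction X) kerm_px_ker_act).
Qed.

Lemma px_ker_precrossed :
  zmor SA (ker SA (px_hom f)) B ∘ px_ker_act =
  conj_action SA B ∘ flat_map SA (idm B) (zmor SA (ker SA (px_hom f)) B).
Proof. rewrite zmor_comp, flat_map_zmor, comp_zmor. reflexivity. Qed.

Definition px_ker : PXMod := {|
  px_ob := ker SA (px_hom f);
  px_bd := zmor SA (ker SA (px_hom f)) B;
  px_act := px_ker_act;
  px_isAction := px_ker_isAction;
  px_precrossed := px_ker_precrossed
|}.

Lemma px_kerm_bd :
  px_bd X ∘ kerm SA (px_hom f) = zmor SA (ker SA (px_hom f)) B.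
Proof.
rewrite <- (px_hom_bd f), <- comp_assoc, kerm_zero. apply comp_zmor.
Qed.

Definition px_kerm : px_ker ~> X :=
  @Build_PXHom px_ker X (kerm SA (px_hom f)) px_kerm_bd kerm_px_ker_act.

Lemma px_kerm_isPullback (i : px_zero ~> Y) :
  exists z : px_ker ~> px_zero, IsPullback f i px_kerm z.
Proof.
assert (H1 : px_bd px_zero ∘ to_zero SA px_ker = px_bd px_ker) by reflexivity.
assert (H2 : to_zero SA px_ker ∘ px_act px_ker =
  px_act px_zero ∘ flat_map SA (idm B) (to_zero SA px_ker))
  by apply to_zero_unique.
exists (Build_PXHom H1 H2). split.
- apply PXHom_eq; simpl. rewrite kerm_zero. unfold zmor. f_equal.
  apply from_zero_unique.
- intros T x y e.
  assert (e' : px_hom f ∘ px_hom x = zmor SA T Y).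
  { apply (f_equal (@px_hom _ _)) in e; simpl in e. rewrite e. unfold zmor.
    rewrite (from_zero_unique (px_hom i) (from_zero SA Y)).
    f_equal. apply to_zero_unique. }
  assert (K1 : px_bd px_ker ∘ ker_lift e' = px_bd T).
  { rewrite <- (px_hom_bd px_kerm), <- comp_assoc. simpl.
    rewrite kerm_lift. apply px_hom_bd. }
  assert (K2 : ker_lift e' ∘ px_act T =
    px_act px_ker ∘ flat_map SA (idm B) (ker_lift e')).
  { apply (kerm_mono (f:=px_hom f)). simpl.
    rewrite !comp_assoc, kerm_lift, kerm_px_ker_act, <- comp_assoc,
      <- flat_map_comp, kerm_lift, comp_id_l. apply px_hom_act. }
  exists (@Build_PXHom T px_ker (ker_lift e') K1 K2). split; [split |].
  + apply PXHom_eq. apply kerm_lift.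
  + apply PXHom_eq. apply to_zero_unique.
  + intros u [eu _]. apply PXHom_eq. apply (kerm_mono (f:=px_hom f)). simpl.
    rewrite kerm_lift. rewrite <- eu. reflexivity.
Qed.

End Kernel.

Record ReflGraph := {
  rg_ob :> C;
  rg_d : rg_ob ~> B;
  rg_c : rg_ob ~> B;
  rg_e : B ~> rg_ob;
  rg_de : rg_d ∘ rg_e = idm B;
  rg_ce : rg_c ∘ rg_e = idm B
}.

(* [G] corresponds to [X], with [k : X ~> G] the kernel of the domain map:
   the underlying object of [G] is the semidirect product of [X] and [B]. *)
Definition IsNormalization (X : PXMod) (G : ReflGraph)
    (k : px_ob X ~> rg_ob G) : Prop :=
  IsSemidirect (px_act X) (rg_d G) (rg_e G) k /\ px_bd X = rg_c G ∘ k.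

Section Composite.
Variables G H : ReflGraph.

Definition rg_pb : Pullback (rg_d G) (rg_c H) := pullback SA (rg_d G) (rg_c H).

Lemma rg_unit_subproof : rg_d G ∘ rg_e G = rg_c H ∘ rg_e H.
Proof. rewrite rg_de, rg_ce. reflexivity. Qed.

Definition rg_unit : B ~> pb_ob rg_pb := pb_pair rg_pb rg_unit_subproof.

Lemma rg_unit_d : rg_d H ∘ pb_snd rg_pb ∘ rg_unit = idm B.
Proof.
unfold rg_unit. rewrite <- comp_assoc, pb_pair_snd. apply rg_de.
Qed.

Lemma rg_unit_c : rg_c G ∘ pb_fst rg_pb ∘ rg_unit = idm B.
Proof.
unfold rg_unit. rewrite <- comp_assoc, pb_pair_fst. apply rg_ce.
Qed.

(* The reflexive graph on the pullback of [rg_d G] and [rg_c H] *)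
Definition rg_comp : ReflGraph := {|
  rg_ob := pb_ob rg_pb;
  rg_d := rg_d H ∘ pb_snd rg_pb;
  rg_c := rg_c G ∘ pb_fst rg_pb;
  rg_e := rg_unit;
  rg_de := rg_unit_d;
  rg_ce := rg_unit_c
|}.

End Composite.

(* The precrossed module X ⋊ Y.  Its underlying object is the semidirect
   product for the pullback action of [px_act X] along [px_bd Y]; the
   comparison [sd_k] identifies it with the normalization of
   [rg_comp sd_X1 sd_Y1].  Since [sd_j] and [sd_i] are jointly epic, the last
   four equations determine that identification. *)
Record PXSemidirect (X Y : PXMod) := {
  sd_ob : PXMod;
  sd_j : X ~> sd_ob;
  sd_i : Y ~> sd_ob;
  sd_p : px_ob sd_ob ~> px_ob Y;
  sd_point : IsSemidirect (pullback_action (px_bd Y) (px_act X))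
    sd_p (px_hom sd_i) (px_hom sd_j);
  sd_X1 : ReflGraph;
  sd_kX : px_ob X ~> rg_ob sd_X1;
  sd_X1_normalization : IsNormalization sd_kX;
  sd_Y1 : ReflGraph;
  sd_kY : px_ob Y ~> rg_ob sd_Y1;
  sd_Y1_normalization : IsNormalization sd_kY;
  sd_k : px_ob sd_ob ~> rg_ob (rg_comp sd_X1 sd_Y1);
  sd_normalization : IsNormalization sd_k;
  sd_j_fst : pb_fst (rg_pb sd_X1 sd_Y1) ∘ (sd_k ∘ px_hom sd_j) = sd_kX;
  sd_j_snd : pb_snd (rg_pb sd_X1 sd_Y1) ∘ (sd_k ∘ px_hom sd_j) = zmor SA X sd_Y1;
  sd_i_fst : pb_fst (rg_pb sd_X1 sd_Y1) ∘ (sd_k ∘ px_hom sd_i) =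
    rg_e sd_X1 ∘ px_bd Y;
  sd_i_snd : pb_snd (rg_pb sd_X1 sd_Y1) ∘ (sd_k ∘ px_hom sd_i) = sd_kY
}.

(* The Peiffer product X ⋈ Y, with all the data entering its construction *)
Record PeifferProduct (X Y : PXMod) := {
  pp_coproduct : Coproduct X Y;
  pp_XY : PXSemidirect X Y;
  pp_YX : PXSemidirect Y X;
  pp_pushout : Pushout
    (cp_copair pp_coproduct (sd_j pp_XY) (sd_i pp_XY))
    (cp_copair pp_coproduct (sd_i pp_YX) (sd_j pp_YX))
}.

(* The diagonal Σ : X + Y ~> X ⋈ Y *)
Definition pp_diag (X Y : PXMod) (P : PeifferProduct X Y) :
  cp_ob (pp_coproduct P) ~> po_ob (pp_pushout P) :=
  po_fst (pp_pushout P) ∘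
  cp_copair (pp_coproduct P) (sd_j (pp_XY P)) (sd_i (pp_XY P)).

(* The subobject [h] of [A] is the Peiffer commutator of [m] and [n].  It is
   determined up to isomorphism, as all the data of a [PeifferProduct] are. *)
Definition IsPeifferCommutator (X Y A H : PXMod) (m : X ~> A) (n : Y ~> A)
    (h : H ~> A) : Prop :=
  exists P : PeifferProduct X Y,
    IsImage (cp_copair (pp_coproduct P) m n ∘ px_kerm (pp_diag P)) h.

(* The zero subobjects of the quasi-pointed category [PXMod] are those with
   initial domain. *)
Definition PeifferCommutatorIsZero (X Y A : PXMod) (m : X ~> A) (n : Y ~> A) :
    Prop :=
  exists (H : PXMod) (h : H ~> A), IsPeifferCommutator m n h /\ IsInitial H.

End PrecrossedModules.

(* Main.v *)
Require Import Defs.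

(** Let [k : K ~> X] be the kernel of [f].  Both conditions on [f] say that [K] and
    [X] satisfy the Peiffer condition inside [X], each acting on the other
    ([PeifferActs]): [X] acts on [K] by conjugation as it does through [∂], and [K],
    on which [∂] vanishes, commutes with [X].

    For precrossed modules [m : M ~> A] and [n : N ~> A], the two quotients
    [M ⋊ N] and [N ⋊ M] of the coproduct are cokernels in [C], so the Peiffer
    commutator vanishes if and only if [[m, n]] factors through both.  In [C], a
    factorization through [M ⋊ N] is a Peiffer condition, by the universal
    property of the semidirect product.  The factorization must also respect the
    action of [B], and in a general semi-abelian category this does not follow from
    what happens on [M] and [N].  It amounts to the Peiffer condition for the action
    on [M] of the whole object of arrows [N ⋊ B] ([GraphActs], [semidirect_desc]).
    This is where (UA) enters: if [M] is normal in [A ⋊ B], then the actions of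
    [N ⋊ B] on [M] by conjugation and through the codomain map agree on [N] and
    on [B], which jointly cover [N ⋊ B], so they are equal
    ([graphActs_of_peifferActs]).

    If [f] is central, let [P] be a pullback of [f] that is a trivial extension of
    [Z].  Then [P] embeds in the product of [Z] and the reflection of [P].  The
    Peiffer conditions for [K] and [P] hold in both components, since [K] vanishes
    in the first and the second is a crossed module; they descend along the regular
    epimorphism from [P] to [X] ([peifferActs_of_central]).

    If the commutator vanishes, the factorization through [X ⋊ K] is a
    multiplication map from [K × X] to [X], which makes [K × X] the kernel pair of
    [f].  So [f], pulled back along itself, is the projection from [K × X] to [X].
    As [K] is abelian and the image of [∂] acts trivially on it, the product of [K]
    with the reflection [GX] of [X] is a crossed module and is the reflection of
    [K × X]; the naturality square is then a pullback of product projections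
    ([central_of_semidirects]).

    Semidirect products come from the coequalizer of the free presentation of an
    action, which the kernel functor preserves ([semidirect_exists]).  Colimits of
    precrossed modules are computed on objects of arrows ([px_pushout_exists]), and
    the reflection is a pushout ([reflection_exists]).  Coequalizers in [C] rest on
    the Mal'tsev property, a consequence of protomodularity
    ([relation_difunctional]). *)

Set Implicit Arguments.
Unset Strict Implicit.
Unset Printing Implicit Defensive.

(** * Monomorphisms, regular epimorphisms and pullbacks *)

Section Basics.
Variable C : Category.

Lemma reassoc (A B D : C) (g : B ~> D) (f : A ~> B) (h : A ~> D) :
  g ∘ f = h -> forall (T : C) (x : T ~> A), g ∘ (f ∘ x) = h ∘ x.
Proof. intros e T x. rewrite comp_assoc, e. reflexivity. Qed.

Definition IsExtremalEpi (A B : C) (f : A ~> B) : Prop :=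
  forall (M : C) (m : M ~> B) (g : A ~> M), IsMono m -> m ∘ g = f -> IsIso m.

Lemma iso_of_mono_section (A B : C) (m : A ~> B) (s : B ~> A) :
  IsMono m -> m ∘ s = idm B -> IsIso m.
Proof.
intros mm e. exists s. split; [apply mm | exact e].
rewrite comp_assoc, e, comp_id_l, comp_id_r. reflexivity.
Qed.

Lemma regularEpi_epi (A B : C) (f : A ~> B) :
  IsRegularEpi f -> forall (T : C) (x y : B ~> T), x ∘ f = y ∘ f -> x = y.
Proof.
intros [Z [a [b [e H]]]] T x y exy.
destruct (H T (y ∘ f)) as [u [_ Hu]].
- rewrite <- !comp_assoc, e. reflexivity.
- rewrite <- (Hu x exy). apply Hu. reflexivity.
Qed.

Lemma regularEpi_factor (A B : C) (f : A ~> B) (T : C) (g : A ~> T) :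
  IsRegularEpi f ->
  (forall (W : C) (x y : W ~> A), f ∘ x = f ∘ y -> g ∘ x = g ∘ y) ->
  exists h : B ~> T, h ∘ f = g.
Proof.
intros [Z [a [b [e H]]]] Hg. destruct (H T g (Hg Z a b e)) as [h [eh _]].
exists h. exact eh.
Qed.

Lemma regularEpi_fill (A B M D : C) (f : A ~> B) (m : M ~> D)
    (a : A ~> M) (b : B ~> D) :
  IsRegularEpi f -> IsMono m -> m ∘ a = b ∘ f ->
  exists w : B ~> M, w ∘ f = a /\ m ∘ w = b.
Proof.
intros rf mm e. destruct (@regularEpi_factor A B f M a rf) as [w ew].
- intros W x y exy. apply mm. rewrite !comp_assoc, e, <- !comp_assoc, exy.
  reflexivity.
- exists w. split; [exact ew |]. apply (regularEpi_epi rf).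
  rewrite <- comp_assoc, ew. exact e.
Qed.

Lemma regularEpi_extremal (A B : C) (f : A ~> B) :
  IsRegularEpi f -> IsExtremalEpi f.
Proof.
intros rf M m g mm e.
destruct (@regularEpi_fill A B M B f m g (idm B) rf mm) as [w [_ ew]].
- rewrite comp_id_l. exact e.
- exact (iso_of_mono_section mm ew).
Qed.

Lemma regularEpi_iso_comp (A B D : C) (f : A ~> B) (m : B ~> D) :
  IsRegularEpi f -> IsIso m -> IsRegularEpi (m ∘ f).
Proof.
intros [Z [a [b [e H]]]] [n [e1 e2]]. exists Z, a, b. split.
- rewrite <- !comp_assoc, e. reflexivity.
- intros T t et. destruct (H T t et) as [u [eu Hu]].
  exists (u ∘ n). split.
  + rewrite <- comp_assoc, (comp_assoc n), e1, comp_id_l. exact eu.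
  + intros v ev. rewrite (Hu (v ∘ m)), <- comp_assoc, e2, comp_id_r.
    * reflexivity.
    * rewrite <- comp_assoc. exact ev.
Qed.

Lemma regularEpi_of_section (A B : C) (f : A ~> B) (s : B ~> A) :
  f ∘ s = idm B -> IsRegularEpi f.
Proof.
intros e. exists A, (idm A), (s ∘ f). split.
- rewrite comp_assoc, e, comp_id_l, comp_id_r. reflexivity.
- intros T t et. rewrite comp_id_r in et. exists (t ∘ s). split.
  + rewrite <- comp_assoc. symmetry. exact et.
  + intros v ev. rewrite <- ev, <- comp_assoc, e, comp_id_r. reflexivity.
Qed.

Lemma extremalEpi_cancel (A B D : C) (g : B ~> D) (f : A ~> B) :
  IsExtremalEpi (g ∘ f) -> IsExtremalEpi g.
Proof.
intros H M m h mm e. apply (H M m (h ∘ f) mm).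
rewrite comp_assoc, e. reflexivity.
Qed.

Lemma IsPullback_sym (A B D P : C) (f : A ~> D) (g : B ~> D)
    (p : P ~> A) (q : P ~> B) : IsPullback f g p q -> IsPullback g f q p.
Proof.
intros [e H]. split; [symmetry; exact e |].
intros T x y exy. destruct (H T y x (eq_sym exy)) as [u [[e1 e2] Hu]].
exists u. split; [split; assumption |]. intros v [e3 e4]. apply Hu.
split; assumption.
Qed.

Lemma IsPullback_ext (A B D P : C) (f : A ~> D) (g : B ~> D)
    (p : P ~> A) (q : P ~> B) : IsPullback f g p q ->
  forall (T : C) (x y : T ~> P), p ∘ x = p ∘ y -> q ∘ x = q ∘ y -> x = y.
Proof.
intros [e H] T x y e1 e2. destruct (H T (p ∘ y) (q ∘ y)) as [u [_ Hu]].
- rewrite !comp_assoc, e. reflexivity.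
- rewrite <- (Hu x (conj e1 e2)). apply Hu. split; reflexivity.
Qed.

Lemma IsPullback_lift (A B D P : C) (f : A ~> D) (g : B ~> D)
    (p : P ~> A) (q : P ~> B) : IsPullback f g p q ->
  forall (T : C) (x : T ~> A) (y : T ~> B), f ∘ x = g ∘ y ->
  exists u : T ~> P, p ∘ u = x /\ q ∘ u = y.
Proof.
intros [_ H] T x y e. destruct (H T x y e) as [u [eu _]]. exists u. exact eu.
Qed.

Lemma pb_square (A B D : C) (f : A ~> D) (g : B ~> D) (P : Pullback f g) :
  f ∘ pb_fst P = g ∘ pb_snd P.
Proof. exact (proj1 (pb_isPullback P)). Qed.

Lemma mono_of_iso (A B : C) (m : A ~> B) : IsIso m -> IsMono m.
Proof.
intros [n [e _]] T x y exy.
rewrite <- (comp_id_l x), <- (comp_id_l y), <- e, <- !comp_assoc, exy.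
reflexivity.
Qed.

End Basics.

Ltac ras := rewrite <- ?comp_assoc, ?comp_id_l, ?comp_id_r.

Section Regular.
Variables (C : Category) (SA : SemiAbelian C).

Definition prod (A B : C) : C :=
  pb_ob (pullback SA (to_zero SA A) (to_zero SA B)).
Definition pr1 (A B : C) : prod A B ~> A :=
  pb_fst (pullback SA (to_zero SA A) (to_zero SA B)).
Definition pr2 (A B : C) : prod A B ~> B :=
  pb_snd (pullback SA (to_zero SA A) (to_zero SA B)).
Definition pair (A B T : C) (x : T ~> A) (y : T ~> B) : T ~> prod A B :=
  pb_pair (pullback SA (to_zero SA A) (to_zero SA B))
    (to_zero_unique (to_zero SA A ∘ x) (to_zero SA B ∘ y)).

Lemma pr1_pair (A B T : C) (x : T ~> A) (y : T ~> B) : pr1 A B ∘ pair x y = x.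
Proof. apply pb_pair_fst. Qed.

Lemma pr2_pair (A B T : C) (x : T ~> A) (y : T ~> B) : pr2 A B ∘ pair x y = y.
Proof. apply pb_pair_snd. Qed.

Lemma pair_inj (A B T : C) (x x' : T ~> A) (y y' : T ~> B) :
  pair x y = pair x' y' -> x = x' /\ y = y'.
Proof.
intros e. split.
- rewrite <- (pr1_pair x y), e. apply pr1_pair.
- rewrite <- (pr2_pair x y), e. apply pr2_pair.
Qed.

Lemma prod_ext (A B T : C) (x y : T ~> prod A B) :
  pr1 A B ∘ x = pr1 A B ∘ y -> pr2 A B ∘ x = pr2 A B ∘ y -> x = y.
Proof. apply pb_ext. Qed.

Lemma pair_comp (A B T W : C) (x : T ~> A) (y : T ~> B) (t : W ~> T) :
  pair x y ∘ t = pair (x ∘ t) (y ∘ t).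
Proof.
apply prod_ext; rewrite comp_assoc.
- rewrite !pr1_pair. reflexivity.
- rewrite !pr2_pair. reflexivity.
Qed.

Lemma regularEpi_pullback (A B D P : C) (f : A ~> D) (g : B ~> D)
    (p : P ~> A) (q : P ~> B) :
  IsPullback f g p q -> IsRegularEpi f -> IsRegularEpi q.
Proof. exact (proj2 (proj1 (semiabelian_exact SA)) A B D P f g p q). Qed.

(** Generalized elements lift along regular epimorphisms after passing to a
    cover of their domain; this is what replaces choosing preimages. *)
Lemma regularEpi_cover (A B T : C) (f : A ~> B) (t : T ~> B) :
  IsRegularEpi f ->
  exists (T' : C) (c : T' ~> T) (t' : T' ~> A), IsRegularEpi c /\ f ∘ t' = t ∘ c.
Proof.
intros rf. pose (P := pullback SA f t).
exists (pb_ob P), (pb_snd P), (pb_fst P). split; [| apply pb_square].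
exact (regularEpi_pullback (pb_isPullback P) rf).
Qed.

(** The second factor is monic because equality can be tested on a cover, where
    two maps that it identifies lift to a map into the kernel pair of [f]. *)
Lemma image_factorization (A B : C) (f : A ~> B) :
  exists (I : C) (e : A ~> I) (m : I ~> B),
    IsRegularEpi e /\ IsMono m /\ m ∘ e = f.
Proof.
pose (P := pullback SA f f).
destruct (proj1 (proj1 (semiabelian_exact SA)) A B (pb_ob P) f
  (pb_fst P) (pb_snd P) (pb_isPullback P)) as [I [e He]].
assert (re : IsRegularEpi e) by (exists (pb_ob P), (pb_fst P), (pb_snd P); exact He).
destruct He as [ee He].
destruct (He B f (pb_square P)) as [m [em _]].
exists I, e, m. split; [exact re |]. split; [| exact em].
intros T x y exy.
destruct (regularEpi_cover x re) as [T1 [c1 [x1 [rc1 ex1]]]].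
destruct (regularEpi_cover (y ∘ c1) re) as [T2 [c2 [y2 [rc2 ey2]]]].
assert (e12 : f ∘ (x1 ∘ c2) = f ∘ y2).
{ rewrite <- em, <- !comp_assoc, ey2, (reassoc ex1), <- !comp_assoc.
  rewrite (reassoc exy). ras. reflexivity. }
apply (regularEpi_epi rc1), (regularEpi_epi rc2).
rewrite <- ey2, <- ex1, <- comp_assoc.
destruct (IsPullback_lift (pb_isPullback P) e12) as [u [<- <-]].
rewrite !comp_assoc, ee. reflexivity.
Qed.

Lemma extremalEpi_regular (A B : C) (f : A ~> B) :
  IsExtremalEpi f -> IsRegularEpi f.
Proof.
intros H. destruct (image_factorization f) as [I [e [m [re [mm em]]]]].
rewrite <- em. apply regularEpi_iso_comp; [exact re |]. exact (H _ m e mm em).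
Qed.

Lemma regularEpi_cancel (A B D : C) (g : B ~> D) (f : A ~> B) :
  IsRegularEpi (g ∘ f) -> IsRegularEpi g.
Proof.
intros H. apply extremalEpi_regular, (@extremalEpi_cancel _ _ _ _ g f).
exact (regularEpi_extremal H).
Qed.

Lemma regularEpi_comp (A B D : C) (g : B ~> D) (f : A ~> B) :
  IsRegularEpi g -> IsRegularEpi f -> IsRegularEpi (g ∘ f).
Proof.
intros rg rf. apply extremalEpi_regular. intros M m h mm e.
destruct (regularEpi_fill rf mm e) as [w [_ ew]].
exact (regularEpi_extremal rg mm ew).
Qed.

Lemma copair_regular (A B D : C) (f : A ~> D) (g : B ~> D) :
  IsJointlyExtremalEpi f g -> IsRegularEpi (copair SA f g).
Proof.
intros H. apply extremalEpi_regular. intros M m h mm e.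
apply (H M m (h ∘ inj1 SA A B) (h ∘ inj2 SA A B) mm);
  rewrite comp_assoc, e; [apply copair_inj1 | apply copair_inj2].
Qed.

Lemma jointlyExtremal_sym (A B D : C) (f : A ~> D) (g : B ~> D) :
  IsJointlyExtremalEpi f g -> IsJointlyExtremalEpi g f.
Proof. intros H M m g' f' mm eg ef. exact (H M m f' g' mm ef eg). Qed.

Lemma jointlyExtremal_epi (A B D T : C) (f : A ~> D) (g : B ~> D)
    (x y : D ~> T) :
  IsJointlyExtremalEpi f g -> x ∘ f = y ∘ f -> x ∘ g = y ∘ g -> x = y.
Proof.
intros H e1 e2. apply (regularEpi_epi (copair_regular H)).
rewrite !comp_copair, e1, e2. reflexivity.
Qed.

(** * Kernels, points and protomodularity *)

Lemma IsKernel_mono (K A B : C) (k : K ~> A) (f : A ~> B) :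
  IsKernel SA k f -> IsMono k.
Proof.
intros [e H] T x y exy. destruct (H T (k ∘ y)) as [u [_ Hu]].
- rewrite comp_assoc, e. apply zmor_comp.
- rewrite <- (Hu x exy). apply Hu. reflexivity.
Qed.

Lemma IsKernel_lift (K A B : C) (k : K ~> A) (f : A ~> B) :
  IsKernel SA k f -> forall (T : C) (t : T ~> A), f ∘ t = zmor SA T B ->
  exists u : T ~> K, k ∘ u = t.
Proof. intros [_ H] T t e. destruct (H T t e) as [u [eu _]]. exists u; exact eu. Qed.

Lemma IsKernel_intro (K A B : C) (k : K ~> A) (f : A ~> B) :
  IsMono k -> f ∘ k = zmor SA K B ->
  (forall (T : C) (t : T ~> A), f ∘ t = zmor SA T B -> exists u, k ∘ u = t) ->
  IsKernel SA k f.
Proof.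
intros mk e H. split; [exact e |]. intros T t et.
destruct (H T t et) as [u eu]. exists u. split; [exact eu |].
intros v ev. apply mk. rewrite eu, ev. reflexivity.
Qed.

Lemma kernel_isPullback (K A B : C) (k : K ~> A) (f : A ~> B) :
  IsKernel SA k f -> IsPullback (from_zero SA B) f (to_zero SA K) k.
Proof.
intros Hk. split; [symmetry; exact (proj1 Hk) |].
intros T x y e. destruct (IsKernel_lift Hk (t:=y)) as [u eu].
- rewrite <- e. unfold zmor. f_equal. apply to_zero_unique.
- exists u. split; [split; [apply to_zero_unique | exact eu] |].
  intros v [_ ev]. apply (IsKernel_mono Hk). rewrite eu, ev. reflexivity.
Qed.

(** This is protomodularity along the map out of zero, for which the pullback
    functor on points is the kernel functor. *)
Lemma point_iso (B E E' K : C) (p : E ~> B) (s : B ~> E)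
    (p' : E' ~> B) (s' : B ~> E') (h : E ~> E') (k : K ~> E) :
  p ∘ s = idm B -> p' ∘ s' = idm B -> p' ∘ h = p -> h ∘ s = s' ->
  IsKernel SA k p -> IsKernel SA (h ∘ k) p' -> IsIso h.
Proof.
intros e1 e2 e3 e4 H H'.
apply (semiabelian_protomodular SA e1 e2 e3 e4
  (kernel_isPullback H) (kernel_isPullback H') (k:=idm K)).
- apply comp_id_r.
- apply comp_id_r.
- exists (idm K). split; apply comp_id_l.
Qed.

(** A subobject of the total object of a point that contains the section and the
    kernel is a point with the same kernel, hence everything. *)
Lemma point_jointlyExtremal (B E K : C) (p : E ~> B) (s : B ~> E) (k : K ~> E) :
  p ∘ s = idm B -> IsKernel SA k p -> IsJointlyExtremalEpi s k.
Proof.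
intros e H M m s' k' mm es ek.
apply (@point_iso B M E K (p ∘ m) s' p s m k'); auto.
- rewrite <- comp_assoc, es. exact e.
- apply IsKernel_intro.
  + intros T x y exy. apply (IsKernel_mono H). rewrite <- ek, <- !comp_assoc, exy.
    reflexivity.
  + rewrite <- comp_assoc, ek. apply (proj1 H).
  + intros T t et. rewrite <- comp_assoc in et.
    destruct (IsKernel_lift H et) as [u eu]. exists u. apply mm.
    rewrite comp_assoc, ek. exact eu.
- rewrite ek. exact H.
Qed.

Lemma pullback_kernel (A B D P K : C) (f : A ~> D) (g : B ~> D)
    (p : P ~> A) (q : P ~> B) (k : K ~> B) (k' : K ~> P) :
  IsPullback f g p q -> IsKernel SA k g ->
  p ∘ k' = zmor SA K A -> q ∘ k' = k -> IsKernel SA k' p.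
Proof.
intros H Hk e1 e2. apply IsKernel_intro; [| exact e1 |].
- intros T x y exy. apply (IsKernel_mono Hk).
  rewrite <- e2, <- !comp_assoc, exy. reflexivity.
- intros T t et. destruct (IsKernel_lift Hk (t := q ∘ t)) as [u eu].
  + rewrite comp_assoc, <- (proj1 H), <- comp_assoc, et. apply comp_zmor.
  + exists u. apply (IsPullback_ext H); rewrite comp_assoc.
    * rewrite e1, et. apply zmor_comp.
    * rewrite e2. exact eu.
Qed.

(** Every regular epimorphism is the cokernel of its kernel: the kernel pair is
    a point whose kernel is the kernel of [f], so a map out of the domain of [f]
    identifies the two projections as soon as it kills that kernel. *)
Lemma regularEpi_cokernel (A B K T : C) (f : A ~> B) (k : K ~> A) (g : A ~> T) :
  IsRegularEpi f -> IsKernel SA k f -> g ∘ k = zmor SA K T ->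
  exists h : B ~> T, h ∘ f = g.
Proof.
intros rf Hk eg. apply regularEpi_factor; [exact rf |].
pose (R := pullback SA f f).
pose (d := pb_pair R (eq_refl (f ∘ idm A))).
assert (ek : f ∘ zmor SA K A = f ∘ k).
{ rewrite comp_zmor, (proj1 Hk). reflexivity. }
pose (kk := pb_pair R ek).
assert (H : IsKernel SA kk (pb_fst R)).
{ exact (pullback_kernel (pb_isPullback R) Hk (pb_pair_fst R ek)
    (pb_pair_snd R ek)). }
assert (E : g ∘ pb_fst R = g ∘ pb_snd R).
{ apply (jointlyExtremal_epi
    (point_jointlyExtremal (pb_pair_fst R (eq_refl (f ∘ idm A))) H));
    rewrite <- !comp_assoc; fold d.
  - unfold d. rewrite pb_pair_fst, pb_pair_snd. reflexivity.
  - unfold kk. rewrite pb_pair_fst, pb_pair_snd, comp_zmor, eg. reflexivity. }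
intros W x y exy.
destruct (IsPullback_lift (pb_isPullback R) exy) as [u [<- <-]].
rewrite !comp_assoc, E.
reflexivity.
Qed.

(** The short five lemma for a subobject [m] of the domain of [q]: the pullback
    of [q] along [q ∘ m] is a point over [I] whose section and kernel are mapped to
    [R] through [m], so its projection to [R], a regular epimorphism, factors
    through [m]. *)
Lemma mono_iso_of_kernel (I R E K : C) (q : R ~> E) (m : I ~> R)
    (k : K ~> R) (k' : K ~> I) :
  IsMono m -> IsRegularEpi (q ∘ m) -> IsKernel SA k q -> m ∘ k' = k -> IsIso m.
Proof.
intros mm rq Hk ek.
pose (S := pullback SA (q ∘ m) q).
pose (S' := pullback SA (q ∘ m) (q ∘ m)).
assert (em : q ∘ m ∘ pb_fst S' = q ∘ (m ∘ pb_snd S')).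
{ rewrite (pb_square S'). symmetry. apply comp_assoc. }
pose (n := pb_pair S em).
assert (mn : IsMono n).
{ intros T x y exy. apply (pb_ext (P:=S')).
  - rewrite <- (pb_pair_fst S em), <- !comp_assoc. fold n. rewrite exy. reflexivity.
  - apply mm. rewrite !comp_assoc, <- (pb_pair_snd S em), <- !comp_assoc.
    fold n. rewrite exy. reflexivity. }
assert (es : q ∘ m ∘ idm I = q ∘ m) by apply comp_id_r.
assert (e0 : q ∘ m ∘ zmor SA K I = q ∘ k).
{ rewrite comp_zmor, (proj1 Hk). reflexivity. }
assert (e0' : q ∘ m ∘ zmor SA K I = q ∘ m ∘ k').
{ rewrite e0, <- comp_assoc, ek. reflexivity. }
assert (H : IsKernel SA (pb_pair S e0) (pb_fst S)).
{ exact (pullback_kernel (pb_isPullback S) Hk (pb_pair_fst S e0)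
    (pb_pair_snd S e0)). }
assert (Hn : IsIso n).
{ apply (point_jointlyExtremal (pb_pair_fst S es) H
    (f' := pb_pair S' (eq_refl (q ∘ m ∘ idm I))) (g' := pb_pair S' e0') mn);
    apply (pb_ext (P:=S)); rewrite comp_assoc; unfold n;
    rewrite ?pb_pair_fst, ?pb_pair_snd, <- ?comp_assoc, ?pb_pair_fst, ?pb_pair_snd.
  - reflexivity.
  - apply comp_id_r.
  - reflexivity.
  - exact ek. }
destruct Hn as [w [_ ew]].
assert (rs : IsRegularEpi (pb_snd S)).
{ exact (regularEpi_pullback (pb_isPullback S) rq). }
apply (regularEpi_extremal rs (g := pb_snd S' ∘ w) mm).
rewrite comp_assoc, <- (pb_pair_snd S em), <- comp_assoc. fold n.
rewrite ew. apply comp_id_r.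
Qed.

End Regular.

(** * Coequalizers and pushouts *)

Section Colimits.
Variables (C : Category) (SA : SemiAbelian C).

(** The kernel of [p] lies in the image of [e2], so that this is an instance of
    the joint extremality of the section and the kernel of a point. *)
Lemma split_pullback_jointlyExtremal (A B D P : C) (f : A ~> D) (g : B ~> D)
    (p : P ~> A) (q : P ~> B) (s : D ~> A) (e1 : A ~> P) (e2 : B ~> P) :
  IsPullback f g p q ->
  p ∘ e1 = idm A -> p ∘ e2 = s ∘ g -> q ∘ e2 = idm B ->
  IsJointlyExtremalEpi e1 e2.
Proof.
intros H e11 e21 e22 M m a b mm ea eb.
apply (point_jointlyExtremal e11 (kerm_isKernel SA p)
  (f' := a) (g' := b ∘ (q ∘ kerm SA p)) mm ea).
rewrite comp_assoc, eb. apply (IsPullback_ext H); rewrite comp_assoc.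
- rewrite e21, kerm_zero, <- comp_assoc, (comp_assoc g), <- (proj1 H).
  rewrite <- comp_assoc, kerm_zero, !comp_zmor. reflexivity.
- rewrite e22, comp_id_l. reflexivity.
Qed.

(** The Mal'tsev property.  The triples [(a, b, c)] as in the hypotheses form the
    pullback of two points over [R], the pairs [(a, b)] and the pairs [(b, c)]
    projected to [b].  The conclusion is clear for the degenerate triples [(a, b, b)]
    and [(b, b, c)], and these are jointly extremal epic. *)
Lemma relation_difunctional (X R : C) (r1 r2 : R ~> X) :
  (forall (T : C) (x y : T ~> R), r1 ∘ x = r1 ∘ y -> r2 ∘ x = r2 ∘ y -> x = y) ->
  forall (T : C) (a b c : T ~> R), r2 ∘ a = r2 ∘ b -> r1 ∘ b = r1 ∘ c ->
  related r1 r2 (r1 ∘ a) (r2 ∘ c).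
Proof.
intros jm T a b c eab ebc.
pose (L := pullback SA r2 r2). pose (N := pullback SA r1 r1).
pose (P := pullback SA (pb_snd L) (pb_fst N)).
destruct (IsPullback_lift (pb_isPullback L) (eq_refl (r2 ∘ idm R)))
  as [dl [dl1 dl2]].
destruct (IsPullback_lift (pb_isPullback N) (eq_refl (r1 ∘ idm R)))
  as [dn [dn1 dn2]].
assert (E1 : pb_snd L ∘ idm _ = pb_fst N ∘ (dn ∘ pb_snd L)).
{ rewrite comp_assoc, dn1, comp_id_l, comp_id_r. reflexivity. }
assert (E2 : pb_snd L ∘ (dl ∘ pb_fst N) = pb_fst N ∘ idm _).
{ rewrite comp_assoc, dl2, comp_id_l, comp_id_r. reflexivity. }
destruct (IsPullback_lift (pb_isPullback P) E1) as [e1 [e11 e12]].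
destruct (IsPullback_lift (pb_isPullback P) E2) as [e2 [e21 e22]].
pose (o := pair SA (r1 ∘ (pb_fst L ∘ pb_fst P)) (r2 ∘ (pb_snd N ∘ pb_snd P))).
pose (M := pullback SA (pair SA r1 r2) o).
assert (mr : IsMono (pair SA r1 r2)).
{ intros W x y exy. apply jm.
  - rewrite <- (pr1_pair SA r1 r2), <- !comp_assoc, exy. reflexivity.
  - rewrite <- (pr2_pair SA r1 r2), <- !comp_assoc, exy. reflexivity. }
assert (mm : IsMono (pb_snd M)).
{ intros W x y exy. apply (pb_ext (P:=M)); [| exact exy].
  apply mr. rewrite !comp_assoc, (pb_square M), <- !comp_assoc, exy. reflexivity. }
assert (F1 : pair SA r1 r2 ∘ pb_fst L = o ∘ e1).
{ unfold o. rewrite !pair_comp. f_equal; ras.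
  - rewrite e11. ras. reflexivity.
  - rewrite e12, (reassoc dn2). ras. apply pb_square. }
assert (F2 : pair SA r1 r2 ∘ pb_snd N = o ∘ e2).
{ unfold o. rewrite !pair_comp. f_equal; ras.
  - rewrite e21, (reassoc dl1). ras. symmetry. apply pb_square.
  - rewrite e22. ras. reflexivity. }
destruct (IsPullback_lift (pb_isPullback M) F1) as [f1 [_ ef1]].
destruct (IsPullback_lift (pb_isPullback M) F2) as [f2 [_ ef2]].
destruct (split_pullback_jointlyExtremal (pb_isPullback P) e11 e21 e22 mm
  ef1 ef2) as [w [_ ew]].
destruct (IsPullback_lift (pb_isPullback L) eab) as [ab [ab1 ab2]].
destruct (IsPullback_lift (pb_isPullback N) ebc) as [bc [bc1 bc2]].
destruct (IsPullback_lift (pb_isPullback P) (eq_trans ab2 (eq_sym bc1)))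
  as [t [t1 t2]].
assert (G : pair SA r1 r2 ∘ (pb_fst M ∘ (w ∘ t)) = o ∘ t).
{ rewrite comp_assoc, (pb_square M), <- comp_assoc, (comp_assoc _ w), ew. ras.
  reflexivity. }
unfold o in G. rewrite !pair_comp in G. destruct (pair_inj G) as [G1 G2].
exists (pb_fst M ∘ (w ∘ t)). split.
- etransitivity; [exact G1 |]. ras. rewrite t1, ab1. reflexivity.
- etransitivity; [exact G2 |]. ras. rewrite t2, bc2. reflexivity.
Qed.

(** The image of a reflexive pair is a reflexive relation, hence an equivalence
    relation by difunctionality, hence effective.  The last clause says that it is
    the whole kernel pair of the coequalizer. *)
Lemma reflexive_coequalizer (W X : C) (a b : W ~> X) (s : X ~> W) :
  a ∘ s = idm X -> b ∘ s = idm X ->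
  exists (Q : C) (q : X ~> Q), IsCoequalizer a b q /\
  forall (T : C) (x y : T ~> X), q ∘ x = q ∘ y ->
    exists (T' : C) (c : T' ~> T) (w : T' ~> W),
      IsRegularEpi c /\ a ∘ w = x ∘ c /\ b ∘ w = y ∘ c.
Proof.
intros eas ebs.
destruct (image_factorization SA (pair SA a b)) as [R [e [m [re [mm em]]]]].
pose (r1 := pr1 SA X X ∘ m). pose (r2 := pr2 SA X X ∘ m).
assert (er1 : r1 ∘ e = a).
{ unfold r1. rewrite <- comp_assoc, em. apply pr1_pair. }
assert (er2 : r2 ∘ e = b).
{ unfold r2. rewrite <- comp_assoc, em. apply pr2_pair. }
assert (jm : forall (T : C) (x y : T ~> R),
  r1 ∘ x = r1 ∘ y -> r2 ∘ x = r2 ∘ y -> x = y).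
{ intros T x y e1 e2. apply mm. apply prod_ext; rewrite !comp_assoc; assumption. }
assert (es1 : r1 ∘ (e ∘ s) = idm X) by (rewrite comp_assoc, er1; exact eas).
assert (es2 : r2 ∘ (e ∘ s) = idm X) by (rewrite comp_assoc, er2; exact ebs).
assert (ER : IsEquivRel r1 r2).
{ split; [exact jm |]. split; [| split].
  - intros T x. exists (e ∘ s ∘ x).
    rewrite !(comp_assoc _ _ x), es1, es2, comp_id_l. split; reflexivity.
  - intros T x y [r [<- <-]].
    assert (D : related r1 r2 (r1 ∘ (e ∘ s ∘ (r2 ∘ r))) (r2 ∘ (e ∘ s ∘ (r1 ∘ r)))).
    { apply (relation_difunctional jm (b := r)).
      - rewrite comp_assoc, es2. apply comp_id_l.
      - rewrite (comp_assoc _ _ (r1 ∘ r)), es1, comp_id_l. reflexivity. }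
    rewrite !(comp_assoc _ (e ∘ s)), es1, es2, !comp_id_l in D. exact D.
  - intros T x y z [r [<- er]] [r' [er' <-]].
    apply (relation_difunctional jm (b := e ∘ s ∘ y)).
    + rewrite comp_assoc, es2, comp_id_l. exact er.
    + rewrite comp_assoc, es1, comp_id_l. symmetry. exact er'. }
destruct (proj2 (semiabelian_exact SA) X R r1 r2 ER) as [Q0 [q0 H0]].
destruct (proj1 (proj1 (semiabelian_exact SA)) X Q0 R q0 r1 r2 H0)
  as [Q [q [eq Hq]]].
exists Q, q. split; [split |].
- rewrite <- er1, <- er2, !comp_assoc, eq. reflexivity.
- intros T t et. apply Hq. apply (regularEpi_epi re).
  rewrite <- !comp_assoc, er1, er2. exact et.
- intros T x y exy.
  destruct (Hq Q0 q0 (proj1 H0)) as [u [eu _]].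
  assert (exy0 : q0 ∘ x = q0 ∘ y).
  { rewrite <- eu, <- !comp_assoc, exy. reflexivity. }
  destruct (IsPullback_lift H0 exy0) as [r [<- <-]].
  destruct (regularEpi_cover SA r re) as [T' [c [w [rc ew]]]].
  exists T', c, w. split; [exact rc |].
  rewrite <- er1, <- er2, <- !comp_assoc, ew. split; reflexivity.
Qed.

Lemma coequalizer_exists (W X : C) (a b : W ~> X) :
  exists (Q : C) (q : X ~> Q), IsCoequalizer a b q.
Proof.
destruct (@reflexive_coequalizer (sum SA W X) X
  (copair SA a (idm X)) (copair SA b (idm X)) (inj2 SA W X))
  as [Q [q [[eq Hq] _]]]; try apply copair_inj2.
exists Q, q. split.
- rewrite <- (copair_inj1 SA a (idm X)), comp_assoc, eq, <- comp_assoc,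
    copair_inj1. reflexivity.
- intros T t et. apply Hq. rewrite !comp_copair, et. reflexivity.
Qed.

Lemma pushout_exists (A B D : C) (f : D ~> A) (g : D ~> B) :
  exists (Q : C) (p : A ~> Q) (q : B ~> Q), IsPushout f g p q.
Proof.
destruct (coequalizer_exists (inj1 SA A B ∘ f) (inj2 SA A B ∘ g))
  as [Q [q [eq Hq]]].
exists Q, (q ∘ inj1 SA A B), (q ∘ inj2 SA A B). split.
- rewrite <- !comp_assoc. exact eq.
- intros T x y exy. destruct (Hq T (copair SA x y)) as [u [eu Hu]].
  + rewrite !comp_assoc, copair_inj1, copair_inj2. exact exy.
  + exists u. split.
    * rewrite !comp_assoc, eu. split; [apply copair_inj1 | apply copair_inj2].
    * intros v [ev1 ev2]. apply Hu. apply (sum_ext (SA:=SA)).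
      -- rewrite copair_inj1, <- ev1, <- comp_assoc. reflexivity.
      -- rewrite copair_inj2, <- ev2, <- comp_assoc. reflexivity.
Qed.

Lemma IsPushout_ext (A B D Q : C) (f : D ~> A) (g : D ~> B)
    (p : A ~> Q) (q : B ~> Q) : IsPushout f g p q ->
  forall (T : C) (x y : Q ~> T), x ∘ p = y ∘ p -> x ∘ q = y ∘ q -> x = y.
Proof.
intros [e H] T x y e1 e2. destruct (H T (y ∘ p) (y ∘ q)) as [u [_ Hu]].
- rewrite <- !comp_assoc, e. reflexivity.
- rewrite <- (Hu x (conj e1 e2)). apply Hu. split; reflexivity.
Qed.

Lemma IsPushout_desc (A B D Q : C) (f : D ~> A) (g : D ~> B)
    (p : A ~> Q) (q : B ~> Q) : IsPushout f g p q ->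
  forall (T : C) (x : A ~> T) (y : B ~> T), x ∘ f = y ∘ g ->
  exists u : Q ~> T, u ∘ p = x /\ u ∘ q = y.
Proof.
intros [_ H] T x y e. destruct (H T x y e) as [u [eu _]]. exists u. exact eu.
Qed.

End Colimits.

(** * The functor ♭ and semidirect products *)

Section Semidirect.
Variables (C : Category) (SA : SemiAbelian C).

Lemma flat_ker_lift (B X T : C) (t : T ~> sum SA B X) :
  copair SA (idm B) (zmor SA X B) ∘ t = zmor SA T B ->
  exists u : T ~> flat SA B X, flat_ker SA B X ∘ u = t.
Proof. exact (IsKernel_lift (kerm_isKernel SA _) (t:=t)). Qed.

Lemma flat_ker_zero (B X : C) :
  copair SA (idm B) (zmor SA X B) ∘ flat_ker SA B X = zmor SA (flat SA B X) B.
Proof. apply copair_zmor_flat_ker. Qed.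

Lemma copair_flat_map (A B X Y T : C) (u : A ~> B) (v : X ~> Y)
    (x : B ~> T) (y : Y ~> T) :
  copair SA x y ∘ (flat_ker SA B Y ∘ flat_map SA u v) =
  copair SA (x ∘ u) (y ∘ v) ∘ flat_ker SA A X.
Proof. rewrite flat_ker_map, comp_assoc, copair_sum_map. reflexivity. Qed.

Lemma sum_map_regular (A B X Y : C) (u : A ~> B) (v : X ~> Y) :
  IsRegularEpi u -> IsRegularEpi v -> IsRegularEpi (sum_map SA u v).
Proof.
intros ru rv. apply (extremalEpi_regular SA). intros M m g mm e.
assert (e1 : m ∘ (g ∘ inj1 SA A X) = inj1 SA B Y ∘ u).
{ rewrite comp_assoc, e. apply copair_inj1. }
assert (e2 : m ∘ (g ∘ inj2 SA A X) = inj2 SA B Y ∘ v).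
{ rewrite comp_assoc, e. apply copair_inj2. }
destruct (regularEpi_fill ru mm e1) as [w1 [_ ew1]].
destruct (regularEpi_fill rv mm e2) as [w2 [_ ew2]].
apply (iso_of_mono_section (s := copair SA w1 w2) mm).
rewrite comp_copair, ew1, ew2.
apply (sum_ext (SA:=SA)); rewrite comp_id_l; [apply copair_inj1 | apply copair_inj2].
Qed.

Lemma flat_map_regular_snd (B X Y : C) (v : X ~> Y) :
  IsRegularEpi v -> IsRegularEpi (flat_map SA (idm B) v).
Proof.
intros rv.
assert (ri : IsRegularEpi (idm B)).
{ apply (regularEpi_of_section (s := idm B)), comp_id_l. }
apply (fun H => regularEpi_pullback SA (p := flat_ker SA B X) H
  (sum_map_regular ri rv) (g := flat_ker SA B Y)).
split; [symmetry; apply flat_ker_map |].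
intros T x y e. destruct (flat_ker_lift (t := x)) as [u eu].
- transitivity (copair SA (idm B) (zmor SA Y B) ∘ (sum_map SA (idm B) v ∘ x)).
  + rewrite comp_assoc, copair_sum_map, zmor_comp, comp_id_l. reflexivity.
  + rewrite e, comp_assoc, flat_ker_zero. apply zmor_comp.
- exists u. split; [split; [exact eu |] |].
  + apply (flat_ker_mono (SA:=SA)).
    rewrite comp_assoc, flat_ker_map, <- comp_assoc, eu. exact e.
  + intros w [ew _]. apply (flat_ker_mono (SA:=SA)). rewrite eu, ew. reflexivity.
Qed.

(** The comparison [c] from [A + X] to the pullback of [u] and [B + X ~> B] is a
    regular epimorphism, because any subobject of that pullback through which it
    factors contains the kernel of the projection to [B + X], namely the kernel
    of [u].  Restricting [c] to the kernels of the projections to [A] gives the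
    map [u ♭ 1]. *)
Lemma flat_map_regular_fst (A B X : C) (u : A ~> B) :
  IsRegularEpi u -> IsRegularEpi (flat_map SA u (idm X)).
Proof.
intros ru.
assert (ri : IsRegularEpi (idm X)).
{ apply (regularEpi_of_section (s := idm X)), comp_id_l. }
pose (p := copair SA (idm B) (zmor SA X B)).
pose (R := pullback SA u p).
assert (E : u ∘ copair SA (idm A) (zmor SA X A) = p ∘ sum_map SA u (idm X)).
{ unfold p. rewrite comp_copair, copair_sum_map, comp_zmor, zmor_comp, comp_id_l,
    comp_id_r. reflexivity. }
destruct (IsPullback_lift (pb_isPullback R) E) as [c [c1 c2]].
assert (Hc : IsRegularEpi c).
{ apply (extremalEpi_regular SA). intros M m g mm eg.
  assert (Ek : u ∘ kerm SA u = p ∘ zmor SA (ker SA u) (sum SA B X)).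
  { rewrite kerm_zero, comp_zmor. reflexivity. }
  destruct (IsPullback_lift (pb_isPullback R) Ek) as [k [k1 k2]].
  apply (@mono_iso_of_kernel _ SA _ _ _ _ (pb_snd R) m k
    (g ∘ (inj1 SA A X ∘ kerm SA u)) mm).
  - apply (regularEpi_cancel SA (f := g)).
    rewrite <- comp_assoc, eg, c2. exact (sum_map_regular ru ri).
  - exact (pullback_kernel (IsPullback_sym (pb_isPullback R))
      (kerm_isKernel SA u) k2 k1).
  - rewrite comp_assoc, eg. apply (pb_ext (P:=R)); rewrite comp_assoc.
    + rewrite c1, comp_assoc, copair_inj1, comp_id_l. symmetry. exact k1.
    + rewrite c2, k2, comp_assoc. unfold sum_map.
      rewrite copair_inj1, <- comp_assoc, kerm_zero. apply comp_zmor. }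
assert (E0 : u ∘ zmor SA (flat SA B X) A = p ∘ flat_ker SA B X).
{ rewrite comp_zmor. symmetry. apply flat_ker_zero. }
destruct (IsPullback_lift (pb_isPullback R) E0) as [k [k1 k2]].
apply (fun H => regularEpi_pullback SA (p := flat_ker SA A X) H Hc (g := k)).
split.
- apply (pb_ext (P:=R)); rewrite !comp_assoc.
  + rewrite c1, k1, flat_ker_zero, zmor_comp. reflexivity.
  + rewrite c2, k2, flat_ker_map. reflexivity.
- intros T x y e.
  assert (e1 := f_equal (fun z => pb_fst R ∘ z) e). simpl in e1.
  assert (e2 := f_equal (fun z => pb_snd R ∘ z) e). simpl in e2.
  rewrite !comp_assoc, c1, k1, zmor_comp in e1.
  rewrite !comp_assoc, c2, k2 in e2.
  destruct (flat_ker_lift e1) as [v ev].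
  exists v. split; [split; [exact ev |] |].
  + apply (flat_ker_mono (SA:=SA)).
    rewrite comp_assoc, flat_ker_map, <- comp_assoc, ev. exact e2.
  + intros w [ew _]. apply (flat_ker_mono (SA:=SA)). rewrite ev, ew. reflexivity.
Qed.

Lemma flat_map_regular (A B X Y : C) (u : A ~> B) (v : X ~> Y) :
  IsRegularEpi u -> IsRegularEpi v -> IsRegularEpi (flat_map SA u v).
Proof.
intros ru rv.
replace (flat_map SA u v) with (flat_map SA u (idm Y) ∘ flat_map SA (idm A) v).
- apply (regularEpi_comp SA).
  + exact (flat_map_regular_fst Y ru).
  + exact (flat_map_regular_snd A rv).
- rewrite <- flat_map_comp, comp_id_l, comp_id_r. reflexivity.
Qed.

(** The action of [A] through the zero map is the trivial action. *)
Lemma flat_map_zmor_fst (A B X : C) :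
  flat_map SA (zmor SA A B) (idm X) =
  flat_unit SA B X ∘ (copair SA (zmor SA A X) (idm X) ∘ flat_ker SA A X).
Proof.
apply (flat_ker_mono (SA:=SA)). rewrite comp_assoc, flat_ker_unit, flat_ker_map.
unfold sum_map. rewrite comp_assoc, comp_copair, !comp_zmor. reflexivity.
Qed.

Lemma IsSemidirect_jointlyExtremal (B X E : C) (xi : flat SA B X ~> X)
    (p : E ~> B) (s : B ~> E) (j : X ~> E) :
  IsSemidirect xi p s j -> IsJointlyExtremalEpi s j.
Proof. intros [e [H _]]. exact (point_jointlyExtremal e H). Qed.

(** The semidirect product is the quotient of [B + X] that imposes the equation
    [[s, j] ∘ flat_ker = j ∘ xi]: the coequalizer of the free presentation of the
    algebra [xi].  The kernel functor preserves it, because the kernel pair of the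
    quotient is covered by the two maps from [B + B♭X], so the two algebra laws
    make [X] the kernel of the quotient.  The last clause is the universal
    property. *)
Lemma semidirect_exists (B X : C) (xi : flat SA B X ~> X) : IsAction xi ->
  exists (E : C) (p : E ~> B) (s : B ~> E) (j : X ~> E),
    IsSemidirect xi p s j /\
    forall (T : C) (g : B ~> T) (h : X ~> T),
      h ∘ xi = copair SA g h ∘ flat_ker SA B X ->
      exists u : E ~> T, u ∘ s = g /\ u ∘ j = h.
Proof.
intros [Hu Hm].
pose (F := flat SA B X).
pose (a := copair SA (inj1 SA B X) (flat_ker SA B X)).
pose (b := sum_map SA (idm B) xi).
pose (pp := copair SA (idm B) (zmor SA X B)).
destruct (@reflexive_coequalizer _ SA _ _ a b
  (sum_map SA (idm B) (flat_unit SA B X))) as [E [q [Hq Hr]]].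
{ unfold a. rewrite copair_sum_map, flat_ker_unit, comp_id_r.
  apply (sum_ext (SA:=SA)); rewrite ?copair_inj1, ?copair_inj2, comp_id_l;
    reflexivity. }
{ unfold b. unfold sum_map at 1. rewrite copair_sum_map, comp_id_r, <- comp_assoc, Hu.
  apply (sum_ext (SA:=SA)); rewrite ?copair_inj1, ?copair_inj2, comp_id_l, comp_id_r;
    reflexivity. }
assert (rq : IsRegularEpi q) by (exists (sum SA B F), a, b; exact Hq).
destruct Hq as [eq Hq].
assert (ea : pp ∘ a = copair SA (idm B) (zmor SA F B)).
{ unfold pp, a. rewrite comp_copair, copair_inj1, flat_ker_zero. reflexivity. }
assert (eb : pp ∘ b = copair SA (idm B) (zmor SA F B)).
{ unfold pp, b. rewrite copair_sum_map, comp_id_l, zmor_comp. reflexivity. }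
destruct (Hq B pp (eq_trans ea (eq_sym eb))) as [p [ep _]].
pose (s := q ∘ inj1 SA B X). pose (j := q ∘ inj2 SA B X).
assert (eps : p ∘ s = idm B).
{ unfold s. rewrite comp_assoc, ep. apply copair_inj1. }
assert (epj : p ∘ j = zmor SA X B).
{ unfold j. rewrite comp_assoc, ep. apply copair_inj2. }
assert (esj : copair SA s j = q).
{ apply (sum_ext (SA:=SA)); rewrite ?copair_inj1, ?copair_inj2; reflexivity. }
assert (ejx : j ∘ xi = copair SA s j ∘ flat_ker SA B X).
{ rewrite esj. transitivity (q ∘ a ∘ inj2 SA B F).
  - rewrite eq. unfold b, j, sum_map. rewrite <- !comp_assoc, copair_inj2. reflexivity.
  - unfold a. rewrite <- comp_assoc, copair_inj2. reflexivity. }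
exists E, p, s, j. split.
- split; [exact eps |]. split; [| exact ejx].
  assert (mj : IsMono j).
  { intros T x y exy.
    destruct (Hr T (inj2 SA B X ∘ x) (inj2 SA B X ∘ y)) as [T' [c [w [rc [w1 w2]]]]].
    { rewrite !comp_assoc. exact exy. }
    apply (regularEpi_epi rc).
    destruct (flat_ker_lift (t := w)) as [v ev].
    { fold F. rewrite <- ea. rewrite <- comp_assoc, w1. unfold pp.
      rewrite !comp_assoc, copair_inj2, !zmor_comp. reflexivity. }
    assert (v1 : flat_mult SA B X ∘ v = flat_unit SA B X ∘ (x ∘ c)).
    { apply (flat_ker_mono (SA:=SA)).
      rewrite !comp_assoc, flat_ker_mult, flat_ker_unit, <- comp_assoc, ev.
      rewrite <- comp_assoc in w1 |- *. exact w1. }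
    assert (v2 : flat_map SA (idm B) xi ∘ v = flat_unit SA B X ∘ (y ∘ c)).
    { apply (flat_ker_mono (SA:=SA)).
      rewrite !comp_assoc, flat_ker_map, flat_ker_unit, <- comp_assoc, ev.
      rewrite <- comp_assoc in w2 |- *. exact w2. }
    rewrite <- (comp_id_l (x ∘ c)), <- (comp_id_l (y ∘ c)), <- Hu, <- !comp_assoc,
      <- v1, <- v2, !comp_assoc, Hm. reflexivity. }
  apply IsKernel_intro; [exact mj | exact epj |].
  (* The restriction of [q] to kernels is a regular epimorphism that factors
     through the monomorphism [j]. *)
  assert (ek : p ∘ (q ∘ flat_ker SA B X) = zmor SA F B).
  { rewrite comp_assoc, ep. apply flat_ker_zero. }
  destruct (IsKernel_lift (kerm_isKernel SA p) ek) as [v ev].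
  destruct (IsKernel_lift (kerm_isKernel SA p) epj) as [l el].
  assert (rv : IsRegularEpi v).
  { apply (fun H => regularEpi_pullback SA (p := flat_ker SA B X) H rq
      (g := kerm SA p)).
    split; [symmetry; exact ev |]. intros T x y exy.
    destruct (flat_ker_lift (t := x)) as [z ez].
    - fold pp. rewrite <- ep, <- comp_assoc, exy, comp_assoc, kerm_zero.
      apply zmor_comp.
    - exists z. split; [split; [exact ez |] |].
      + apply (kerm_mono (SA:=SA) (f:=p)). rewrite comp_assoc, ev, <- comp_assoc, ez.
        exact exy.
      + intros z' [ez' _]. apply (flat_ker_mono (SA:=SA)). rewrite ez, ez'.
        reflexivity. }
  assert (evl : v = l ∘ xi).
  { apply (kerm_mono (SA:=SA) (f:=p)). rewrite ev, comp_assoc, el, ejx, esj.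
    reflexivity. }
  destruct (regularEpi_extremal rv (m := l) (g := xi)) as [n [_ en]].
  { intros T x y exy. apply mj. rewrite <- el, <- !comp_assoc, exy. reflexivity. }
  { symmetry. exact evl. }
  intros T t et. destruct (IsKernel_lift (kerm_isKernel SA p) et) as [z ez].
  exists (n ∘ z). rewrite <- el, <- comp_assoc, (comp_assoc l), en, comp_id_l.
  exact ez.
- intros T g h e. destruct (Hq T (copair SA g h)) as [u [eu _]].
  + unfold a, b. rewrite comp_copair, copair_sum_map, copair_inj1, comp_id_r, e.
    reflexivity.
  + exists u. unfold s, j. rewrite !comp_assoc, eu.
    split; [apply copair_inj1 | apply copair_inj2].
Qed.

(** Any point with action [xi] is isomorphic to the one just constructed, by
    protomodularity, so it inherits the universal property. *)
Lemma IsSemidirect_desc (B X E : C) (xi : flat SA B X ~> X)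
    (p : E ~> B) (s : B ~> E) (j : X ~> E) :
  IsAction xi -> IsSemidirect xi p s j ->
  forall (T : C) (g : B ~> T) (h : X ~> T),
    h ∘ xi = copair SA g h ∘ flat_ker SA B X ->
    exists u : E ~> T, u ∘ s = g /\ u ∘ j = h.
Proof.
intros Hxi [eps [Hj ej]] T g h e.
destruct (semidirect_exists Hxi) as [E0 [p0 [s0 [j0 [H0 D0]]]]].
destruct (D0 E s j ej) as [w [ws wj]].
assert (ep : p ∘ w = p0).
{ apply (jointlyExtremal_epi SA (IsSemidirect_jointlyExtremal H0));
    rewrite <- comp_assoc.
  - rewrite ws, eps. symmetry. exact (proj1 H0).
  - rewrite wj, (proj1 Hj). symmetry. exact (proj1 (proj1 (proj2 H0))). }
destruct (@point_iso _ SA _ _ _ _ p0 s0 p s w j0) as [v [vw wv]]; auto.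
- exact (proj1 H0).
- exact (proj1 (proj2 H0)).
- rewrite wj. exact Hj.
- destruct (D0 T g h e) as [u [us uj]]. exists (u ∘ v).
  rewrite <- ws, <- wj, <- !comp_assoc, !(comp_assoc v), vw, !comp_id_l.
  split; assumption.
Qed.

(** The algebra laws hold because [j] is monic and [[s, j]] turns them into
    identities in [E]. *)
Lemma conjugation_isAction (B X E : C) (s : B ~> E) (j : X ~> E)
    (xi : flat SA B X ~> X) :
  IsMono j -> j ∘ xi = copair SA s j ∘ flat_ker SA B X -> IsAction xi.
Proof.
intros mj exi. split; apply mj; rewrite comp_assoc, exi.
- rewrite <- comp_assoc, flat_ker_unit, copair_inj2, comp_id_r. reflexivity.
- rewrite <- !comp_assoc, flat_ker_mult, comp_assoc, comp_copair, copair_inj1.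
  rewrite comp_assoc, exi, <- comp_assoc, copair_flat_map, comp_id_r, exi.
  reflexivity.
Qed.

Lemma conjugation_exists (B X E D : C) (s : B ~> E) (j : X ~> E) (p : E ~> D) :
  IsKernel SA j p ->
  exists xi : flat SA B X ~> X,
    IsAction xi /\ j ∘ xi = copair SA s j ∘ flat_ker SA B X.
Proof.
intros Hj.
assert (e : p ∘ (copair SA s j ∘ flat_ker SA B X) = zmor SA (flat SA B X) D).
{ rewrite comp_assoc, comp_copair, (proj1 Hj). apply copair_zmor_flat_ker. }
destruct (IsKernel_lift Hj e) as [xi exi].
exists xi. split; [exact (conjugation_isAction (IsKernel_mono Hj) exi) | exact exi].
Qed.

End Semidirect.

(** * Precrossed modules and reflexive graphs *)

Section Normalization.
Variables (C : Category) (SA : SemiAbelian C) (B : C).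

Lemma px_hom_comp (X Y Z : PXMod SA B) (g : Y ~> Z) (f : X ~> Y) :
  px_hom (g ∘ f) = px_hom g ∘ px_hom f.
Proof. reflexivity. Qed.

Lemma px_hom_id (X : PXMod SA B) : px_hom (idm X) = idm (px_ob X).
Proof. reflexivity. Qed.

Lemma px_precrossed_copair (X : PXMod SA B) :
  px_bd X ∘ px_act X = copair SA (idm B) (px_bd X) ∘ flat_ker SA B X.
Proof.
rewrite (px_precrossed X). unfold conj_action.
rewrite <- comp_assoc, copair_flat_map, !comp_id_l. reflexivity.
Qed.

(** The codomain map of the graph is [[1, ∂]], which exists by the precrossed
    module condition. *)
Lemma normalization_of_px (X : PXMod SA B) :
  exists (G : ReflGraph B) (k : px_ob X ~> rg_ob G), IsNormalization k.
Proof.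
destruct (semidirect_exists (px_isAction X)) as [E [p [s [j [H D]]]]].
destruct (D B (idm B) (px_bd X) (px_precrossed_copair X)) as [c [cs cj]].
exists {| rg_ob := E; rg_d := p; rg_c := c; rg_e := s;
  rg_de := proj1 H; rg_ce := cs |}, j.
split; [exact H | symmetry; exact cj].
Qed.

Lemma normalization_of_rg (G : ReflGraph B) :
  exists (X : PXMod SA B) (k : px_ob X ~> rg_ob G), IsNormalization k.
Proof.
destruct (conjugation_exists (rg_e G) (kerm_isKernel SA (rg_d G))) as [xi [Hxi H]].
set (k := kerm SA (rg_d G)) in *.
assert (e : rg_c G ∘ k ∘ xi = conj_action SA B ∘ flat_map SA (idm B) (rg_c G ∘ k)).
{ unfold conj_action.
  rewrite <- !comp_assoc, copair_flat_map, !comp_id_l, H.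
  rewrite comp_assoc, comp_copair, rg_ce. reflexivity. }
exists {| px_ob := ker SA (rg_d G); px_bd := rg_c G ∘ k; px_act := xi;
  px_isAction := Hxi; px_precrossed := e |}, k.
split; [| reflexivity].
split; [apply rg_de | split; [apply kerm_isKernel | exact H]].
Qed.

Lemma normalization_kernel (X : PXMod SA B) (G : ReflGraph B)
    (k : px_ob X ~> rg_ob G) : IsNormalization k -> IsKernel SA k (rg_d G).
Proof. intros [[_ [H _]] _]. exact H. Qed.

Lemma normalization_jointlyExtremal (X : PXMod SA B) (G : ReflGraph B)
    (k : px_ob X ~> rg_ob G) :
  IsNormalization k -> IsJointlyExtremalEpi (rg_e G) k.
Proof. intros [H _]. exact (IsSemidirect_jointlyExtremal H). Qed.

Definition IsGraphMap (G H : ReflGraph B) (F : rg_ob G ~> rg_ob H) : Prop :=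
  F ∘ rg_e G = rg_e H /\ rg_d H ∘ F = rg_d G /\ rg_c H ∘ F = rg_c G.

Lemma normalization_desc (X Y : PXMod SA B) (G H : ReflGraph B)
    (k : px_ob X ~> rg_ob G) (l : px_ob Y ~> rg_ob H) (f : X ~> Y) :
  IsNormalization k -> IsNormalization l ->
  exists F : rg_ob G ~> rg_ob H, IsGraphMap F /\ F ∘ k = l ∘ px_hom f.
Proof.
intros Hk Hl.
destruct (@IsSemidirect_desc _ SA _ _ _ _ _ _ _ (px_isAction X) (proj1 Hk) (rg_ob H)
  (rg_e H) (l ∘ px_hom f)) as [F [Fe Fk]].
{ rewrite <- comp_assoc, px_hom_act, comp_assoc, (proj2 (proj2 (proj1 Hl))).
  rewrite <- comp_assoc, copair_flat_map, comp_id_r. reflexivity. }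
exists F. split; [| exact Fk]. split; [exact Fe |].
split; apply (jointlyExtremal_epi SA (normalization_jointlyExtremal Hk));
  rewrite <- comp_assoc, ?Fe, ?Fk.
- rewrite !rg_de. reflexivity.
- rewrite comp_assoc, (proj1 (normalization_kernel Hk)),
    (proj1 (normalization_kernel Hl)). apply zmor_comp.
- rewrite !rg_ce. reflexivity.
- rewrite comp_assoc, <- (proj2 Hk), <- (proj2 Hl). apply px_hom_bd.
Qed.

Lemma normalization_lift (X Y : PXMod SA B) (G H : ReflGraph B)
    (k : px_ob X ~> rg_ob G) (l : px_ob Y ~> rg_ob H) (F : rg_ob G ~> rg_ob H) :
  IsNormalization k -> IsNormalization l -> IsGraphMap F ->
  exists f : X ~> Y, l ∘ px_hom f = F ∘ k.
Proof.
intros Hk Hl [Fe [Fd Fc]].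
destruct (IsKernel_lift (normalization_kernel Hl) (t := F ∘ k)) as [f ef].
{ rewrite comp_assoc, Fd. exact (proj1 (normalization_kernel Hk)). }
assert (e1 : px_bd Y ∘ f = px_bd X).
{ rewrite (proj2 Hk), (proj2 Hl), <- comp_assoc, ef, comp_assoc, Fc. reflexivity. }
assert (e2 : f ∘ px_act X = px_act Y ∘ flat_map SA (idm B) f).
{ apply (IsKernel_mono (normalization_kernel Hl)).
  rewrite !comp_assoc, ef, (proj2 (proj2 (proj1 Hl))).
  rewrite <- !comp_assoc, copair_flat_map, (proj2 (proj2 (proj1 Hk))).
  rewrite comp_assoc, comp_copair, Fe, ef, comp_id_r. reflexivity. }
exists (Build_PXHom e1 e2). exact ef.
Qed.

Lemma graph_pushout_exists (W X Y : ReflGraph B) (f : rg_ob W ~> rg_ob X)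
    (g : rg_ob W ~> rg_ob Y) :
  IsGraphMap f -> IsGraphMap g ->
  exists (Q : ReflGraph B) (p : rg_ob X ~> rg_ob Q) (q : rg_ob Y ~> rg_ob Q),
    IsGraphMap p /\ IsGraphMap q /\ IsPushout f g p q.
Proof.
intros [fe [fd fc]] [ge [gd gc]].
destruct (pushout_exists SA f g) as [Q [p [q H]]].
destruct (IsPushout_desc H (eq_trans fd (eq_sym gd))) as [d [dp dq]].
destruct (IsPushout_desc H (eq_trans fc (eq_sym gc))) as [c [cp cq]].
assert (de : d ∘ (p ∘ rg_e X) = idm B) by (rewrite comp_assoc, dp; apply rg_de).
assert (ce : c ∘ (p ∘ rg_e X) = idm B) by (rewrite comp_assoc, cp; apply rg_ce).
exists {| rg_ob := Q; rg_d := d; rg_c := c; rg_e := p ∘ rg_e X;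
  rg_de := de; rg_ce := ce |}, p, q.
split; [| split; [| exact H]]; (split; [simpl | split; assumption]).
- reflexivity.
- rewrite <- fe, <- ge, !comp_assoc, (proj1 H). reflexivity.
Qed.

(** Pushouts of reflexive graphs over [B] are pushouts of the objects of arrows:
    the domain, codomain and unit maps are induced. *)
Lemma px_pushout_exists (W X Y : PXMod SA B) (f : W ~> X) (g : W ~> Y) :
  exists (Q : PXMod SA B) (p : X ~> Q) (q : Y ~> Q), IsPushout f g p q.
Proof.
destruct (normalization_of_px W) as [W1 [kW HW]].
destruct (normalization_of_px X) as [X1 [kX HX]].
destruct (normalization_of_px Y) as [Y1 [kY HY]].
destruct (normalization_desc f HW HX) as [f1 [Hf fk]].
destruct (normalization_desc g HW HY) as [g1 [Hg gk]].
destruct (graph_pushout_exists Hf Hg) as [G [p1 [q1 [Hp [Hq H1]]]]].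
destruct (normalization_of_rg G) as [Q [k HQ]].
destruct (normalization_lift HX HQ Hp) as [p ep].
destruct (normalization_lift HY HQ Hq) as [q eq].
exists Q, p, q. split.
- apply PXHom_eq. rewrite !px_hom_comp.
  apply (IsKernel_mono (normalization_kernel HQ)).
  rewrite !comp_assoc, ep, eq, <- !comp_assoc, <- fk, <- gk.
  rewrite !comp_assoc, (proj1 H1). reflexivity.
- intros T x y exy.
  destruct (normalization_of_px T) as [T1 [kT HT]].
  destruct (normalization_desc x HX HT) as [x1 [Hx xk]].
  destruct (normalization_desc y HY HT) as [y1 [Hy yk]].
  assert (mT := IsKernel_mono (normalization_kernel HT)).
  assert (exy1 : x1 ∘ f1 = y1 ∘ g1).
  { apply (jointlyExtremal_epi SA (normalization_jointlyExtremal HW));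
      rewrite <- !comp_assoc.
    - rewrite (proj1 Hf), (proj1 Hg), (proj1 Hx), (proj1 Hy). reflexivity.
    - rewrite fk, gk, !comp_assoc, xk, yk, <- !comp_assoc, <- !px_hom_comp, exy.
      reflexivity. }
  destruct (IsPushout_desc H1 exy1) as [u1 [u1p u1q]].
  assert (Hu : IsGraphMap u1).
  { split; [| split].
    - rewrite <- (proj1 Hp), comp_assoc, u1p. exact (proj1 Hx).
    - apply (IsPushout_ext H1); rewrite <- comp_assoc, ?u1p, ?u1q.
      + rewrite (proj1 (proj2 Hx)), (proj1 (proj2 Hp)). reflexivity.
      + rewrite (proj1 (proj2 Hy)), (proj1 (proj2 Hq)). reflexivity.
    - apply (IsPushout_ext H1); rewrite <- comp_assoc, ?u1p, ?u1q.
      + rewrite (proj2 (proj2 Hx)), (proj2 (proj2 Hp)). reflexivity.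
      + rewrite (proj2 (proj2 Hy)), (proj2 (proj2 Hq)). reflexivity. }
  destruct (normalization_lift HQ HT Hu) as [u eu].
  exists u. split; [split |].
  + apply PXHom_eq, mT.
    rewrite px_hom_comp, comp_assoc, eu, <- comp_assoc, ep, comp_assoc, u1p.
    exact xk.
  + apply PXHom_eq, mT.
    rewrite px_hom_comp, comp_assoc, eu, <- comp_assoc, eq, comp_assoc, u1q.
    exact yk.
  + intros v [vp vq].
    destruct (normalization_desc v HQ HT) as [v1 [Hv vk]].
    assert (uv : v1 = u1).
    { apply (IsPushout_ext H1).
      - rewrite u1p. apply (jointlyExtremal_epi SA (normalization_jointlyExtremal HX));
          rewrite <- !comp_assoc.
        + rewrite (proj1 Hp), (proj1 Hv), (proj1 Hx). reflexivity.
        + rewrite <- ep, comp_assoc, vk, <- comp_assoc, <- px_hom_comp, vp, xk.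
          reflexivity.
      - rewrite u1q. apply (jointlyExtremal_epi SA (normalization_jointlyExtremal HY));
          rewrite <- !comp_assoc.
        + rewrite (proj1 Hq), (proj1 Hv), (proj1 Hy). reflexivity.
        + rewrite <- eq, comp_assoc, vk, <- comp_assoc, <- px_hom_comp, vq, yk.
          reflexivity. }
    apply PXHom_eq, mT. rewrite eu, <- vk, uv. reflexivity.
Qed.

Lemma px_coproduct_exists (X Y : PXMod SA B) : inhabited (Coproduct X Y).
Proof.
destruct (px_zero_initial X) as [zx _].
destruct (px_zero_initial Y) as [zy _].
destruct (px_pushout_exists zx zy) as [Q [p [q [_ H]]]].
constructor. exists Q p q. intros T x y. apply H.
destruct (px_zero_initial T) as [zt [_ Hz]].
rewrite <- (Hz (x ∘ zx) I), <- (Hz (y ∘ zy) I). reflexivity.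
Qed.

(** The pullback projections, typed by the composite graph so that they compose
    with its structure maps without unfolding it. *)
Definition comp_fst (G H : ReflGraph B) : rg_ob (rg_comp SA G H) ~> rg_ob G :=
  pb_fst (rg_pb SA G H).
Definition comp_snd (G H : ReflGraph B) : rg_ob (rg_comp SA G H) ~> rg_ob H :=
  pb_snd (rg_pb SA G H).

Lemma comp_isPullback (G H : ReflGraph B) :
  IsPullback (rg_d G) (rg_c H) (comp_fst G H) (comp_snd G H).
Proof. exact (pb_isPullback (rg_pb SA G H)). Qed.

Lemma comp_fst_unit (G H : ReflGraph B) :
  comp_fst G H ∘ rg_e (rg_comp SA G H) = rg_e G.
Proof. apply pb_pair_fst. Qed.

Lemma comp_snd_unit (G H : ReflGraph B) :
  comp_snd G H ∘ rg_e (rg_comp SA G H) = rg_e H.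
Proof. apply pb_pair_snd. Qed.

Lemma comp_d (G H : ReflGraph B) :
  rg_d (rg_comp SA G H) = rg_d H ∘ comp_snd G H.
Proof. reflexivity. Qed.

Lemma comp_c (G H : ReflGraph B) :
  rg_c (rg_comp SA G H) = rg_c G ∘ comp_fst G H.
Proof. reflexivity. Qed.

(** The inclusions are [(1, e d)] and [(e c, 1)]. *)
Lemma comp_inclusions (G H : ReflGraph B) :
  exists (F : rg_ob G ~> rg_ob (rg_comp SA G H))
    (F' : rg_ob H ~> rg_ob (rg_comp SA G H)),
    IsGraphMap F /\ IsGraphMap F' /\
    comp_fst G H ∘ F = idm (rg_ob G) /\ comp_snd G H ∘ F = rg_e H ∘ rg_d G /\
    comp_fst G H ∘ F' = rg_e G ∘ rg_c H /\ comp_snd G H ∘ F' = idm (rg_ob H).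
Proof.
assert (E : rg_d G ∘ idm G = rg_c H ∘ (rg_e H ∘ rg_d G)).
{ rewrite comp_assoc, rg_ce, comp_id_l, comp_id_r. reflexivity. }
assert (E' : rg_d G ∘ (rg_e G ∘ rg_c H) = rg_c H ∘ idm H).
{ rewrite comp_assoc, rg_de, comp_id_l, comp_id_r. reflexivity. }
destruct (IsPullback_lift (comp_isPullback G H) E) as [F [F1 F2]].
destruct (IsPullback_lift (comp_isPullback G H) E') as [F' [F1' F2']].
exists F, F'. split; [| split; [| repeat split; assumption]]; split; [| split | | split].
- apply (IsPullback_ext (comp_isPullback G H)); rewrite comp_assoc.
  + rewrite F1, comp_fst_unit. apply comp_id_l.
  + rewrite F2, comp_snd_unit, <- comp_assoc, rg_de. apply comp_id_r.
- rewrite comp_d, <- comp_assoc, F2, comp_assoc, rg_de. apply comp_id_l.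
- rewrite comp_c, <- comp_assoc, F1. apply comp_id_r.
- apply (IsPullback_ext (comp_isPullback G H)); rewrite comp_assoc.
  + rewrite F1', comp_fst_unit, <- comp_assoc, rg_ce. apply comp_id_r.
  + rewrite F2', comp_snd_unit. apply comp_id_l.
- rewrite comp_d, <- comp_assoc, F2'. apply comp_id_r.
- rewrite comp_c, <- comp_assoc, F1', comp_assoc, rg_ce. apply comp_id_l.
Qed.

(** [S] is the kernel of the domain map of the composite graph.  A map into it is
    determined by its two components in the objects of arrows over [X] and [Y]. *)
Lemma px_semidirect_exists (X Y : PXMod SA B) : inhabited (PXSemidirect X Y).
Proof.
destruct (normalization_of_px X) as [X1 [kX HX]].
destruct (normalization_of_px Y) as [Y1 [kY HY]].
destruct (normalization_of_rg (rg_comp SA X1 Y1)) as [S [k HS]].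
destruct (comp_inclusions X1 Y1) as [FX [FY [GX [GY [FX1 [FX2 [FY1 FY2]]]]]]].
destruct (normalization_lift HX HS GX) as [j ej].
destruct (normalization_lift HY HS GY) as [i ei].
assert (dX := proj1 (normalization_kernel HX)).
assert (mS := IsKernel_mono (normalization_kernel HS)).
assert (mY := IsKernel_mono (normalization_kernel HY)).
assert (mX := IsKernel_mono (normalization_kernel HX)).
assert (j1 : comp_fst X1 Y1 ∘ (k ∘ px_hom j) = kX).
{ rewrite ej, comp_assoc, FX1. apply comp_id_l. }
assert (j2 : comp_snd X1 Y1 ∘ (k ∘ px_hom j) = zmor SA X Y1).
{ rewrite ej, comp_assoc, FX2, <- comp_assoc, dX. apply comp_zmor. }
assert (i1 : comp_fst X1 Y1 ∘ (k ∘ px_hom i) = rg_e X1 ∘ px_bd Y).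
{ rewrite ei, comp_assoc, FY1, <- comp_assoc, <- (proj2 HY). reflexivity. }
assert (i2 : comp_snd X1 Y1 ∘ (k ∘ px_hom i) = kY).
{ rewrite ei, comp_assoc, FY2. apply comp_id_l. }
destruct (IsKernel_lift (normalization_kernel HY) (t := comp_snd X1 Y1 ∘ k))
  as [p ep].
{ rewrite comp_assoc, <- comp_d. exact (proj1 (normalization_kernel HS)). }
constructor.
refine {| sd_ob := S; sd_j := j; sd_i := i; sd_p := p; sd_X1 := X1; sd_kX := kX;
  sd_X1_normalization := HX; sd_Y1 := Y1; sd_kY := kY; sd_Y1_normalization := HY;
  sd_k := k; sd_normalization := HS; sd_j_fst := j1; sd_j_snd := j2;
  sd_i_fst := i1; sd_i_snd := i2 |}.
split; [| split].
- apply mY. rewrite comp_assoc, ep, <- comp_assoc, comp_id_r. exact i2.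
- apply IsKernel_intro.
  + intros T x y exy. apply mX. rewrite <- j1, <- !comp_assoc, exy. reflexivity.
  + apply mY. rewrite comp_assoc, ep, <- comp_assoc, j2, comp_zmor. reflexivity.
  + intros T t et.
    assert (t2 : comp_snd X1 Y1 ∘ (k ∘ t) = zmor SA T Y1).
    { rewrite comp_assoc, <- ep, <- comp_assoc, et. apply comp_zmor. }
    destruct (IsKernel_lift (normalization_kernel HX) (t := comp_fst X1 Y1 ∘ (k ∘ t)))
      as [u eu].
    * rewrite comp_assoc, (proj1 (comp_isPullback X1 Y1)), <- comp_assoc, t2.
      apply comp_zmor.
    * exists u. apply mS. apply (IsPullback_ext (comp_isPullback X1 Y1)).
      -- rewrite <- eu, !comp_assoc, <- (comp_assoc _ k), j1. reflexivity.
      -- rewrite t2, !comp_assoc, <- (comp_assoc _ k), j2. apply zmor_comp.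
- apply mS. apply (IsPullback_ext (comp_isPullback X1 Y1)); unfold pullback_action.
  + rewrite (comp_assoc k), (comp_assoc _ (k ∘ _)), j1, !comp_assoc.
    rewrite (proj2 (proj2 (proj1 HX))), <- (comp_assoc (copair SA _ _)).
    rewrite copair_flat_map, comp_id_r, comp_copair.
    rewrite <- !(comp_assoc _ k), j1, i1. reflexivity.
  + rewrite (comp_assoc k), (comp_assoc _ (k ∘ _)), j2, !comp_assoc, comp_copair.
    rewrite <- !(comp_assoc _ k), j2, i2, !zmor_comp.
    symmetry. apply copair_zmor_flat_ker.
Qed.

End Normalization.

(** * Limits, images and regular epimorphisms of precrossed modules *)

Section PXLimits.
Variables (C : Category) (SA : SemiAbelian C) (B : C).

(** A pair of maps that detects equality and commutes with the structure detects
    the algebra laws, which are equations. *)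
Lemma jointlyMonic_isAction (P X Y : C) (p : P ~> X) (q : P ~> Y)
    (xi : flat SA B X ~> X) (yi : flat SA B Y ~> Y) (pi : flat SA B P ~> P) :
  (forall (T : C) (x y : T ~> P), p ∘ x = p ∘ y -> q ∘ x = q ∘ y -> x = y) ->
  IsAction xi -> IsAction yi ->
  p ∘ pi = xi ∘ flat_map SA (idm B) p -> q ∘ pi = yi ∘ flat_map SA (idm B) q ->
  IsAction pi.
Proof.
assert (U : forall (Z : C) (r : P ~> Z) (zi : flat SA B Z ~> Z), IsAction zi ->
  r ∘ pi = zi ∘ flat_map SA (idm B) r ->
  r ∘ (pi ∘ flat_unit SA B P) = r ∘ idm P /\
  r ∘ (pi ∘ flat_mult SA B P) = r ∘ (pi ∘ flat_map SA (idm B) pi)).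
{ intros Z r zi [H1 H2] e. rewrite !(comp_assoc r), e. split.
  - rewrite <- comp_assoc, flat_unit_natural, comp_assoc, H1, comp_id_l, comp_id_r.
    reflexivity.
  - rewrite <- comp_assoc, flat_mult_natural, comp_assoc, H2.
    rewrite <- !comp_assoc, <- !flat_map_comp, !comp_id_l, e. reflexivity. }
intros jm HX HY ep eq. destruct (U X p xi HX ep) as [p1 p2].
destruct (U Y q yi HY eq) as [q1 q2]. split; apply jm; assumption.
Qed.

Lemma px_hom_of_jointlyMonic (T P X Y : PXMod SA B) (p : P ~> X) (q : P ~> Y)
    (x : T ~> X) (y : T ~> Y) (u : px_ob T ~> px_ob P) :
  (forall (W : C) (a b : W ~> px_ob P),
     px_hom p ∘ a = px_hom p ∘ b -> px_hom q ∘ a = px_hom q ∘ b -> a = b) ->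
  px_hom p ∘ u = px_hom x -> px_hom q ∘ u = px_hom y ->
  exists u' : T ~> P, px_hom u' = u.
Proof.
intros jm e1 e2.
assert (E1 : px_bd P ∘ u = px_bd T).
{ rewrite <- (px_hom_bd p), <- comp_assoc, e1. apply px_hom_bd. }
assert (E2 : u ∘ px_act T = px_act P ∘ flat_map SA (idm B) u).
{ apply jm; rewrite !comp_assoc, px_hom_act, <- (comp_assoc (px_act _)),
    <- flat_map_comp, comp_id_l, ?e1, ?e2; apply px_hom_act. }
exists (Build_PXHom E1 E2). reflexivity.
Qed.

Lemma px_hom_of_mono (T P X : PXMod SA B) (p : P ~> X) (x : T ~> X)
    (u : px_ob T ~> px_ob P) :
  IsMono (px_hom p) -> px_hom p ∘ u = px_hom x -> exists u' : T ~> P, px_hom u' = u.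
Proof.
intros mp e. apply (@px_hom_of_jointlyMonic T P X X p p x x u); auto.
Qed.

Lemma px_hom_of_regularEpi (X Q T : PXMod SA B) (q : X ~> Q) (x : X ~> T)
    (u : px_ob Q ~> px_ob T) :
  IsRegularEpi (px_hom q) -> u ∘ px_hom q = px_hom x ->
  exists u' : Q ~> T, px_hom u' = u.
Proof.
intros rq e.
assert (E1 : px_bd T ∘ u = px_bd Q).
{ apply (regularEpi_epi rq). rewrite <- comp_assoc, e, !px_hom_bd. reflexivity. }
assert (E2 : u ∘ px_act Q = px_act T ∘ flat_map SA (idm B) u).
{ apply (regularEpi_epi (flat_map_regular_snd SA B rq)).
  rewrite <- !comp_assoc, <- px_hom_act, <- flat_map_comp, comp_id_l.
  rewrite comp_assoc, e. apply px_hom_act. }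
exists (Build_PXHom E1 E2). reflexivity.
Qed.

Lemma px_copair_regular (X Y W : PXMod SA B) (S : Coproduct X Y)
    (i : X ~> W) (j : Y ~> W) :
  IsJointlyExtremalEpi (px_hom i) (px_hom j) ->
  IsRegularEpi (px_hom (cp_copair S i j)).
Proof.
intros H. apply (extremalEpi_regular SA). intros M m g mm e.
apply (H M m (g ∘ px_hom (cp_inl S)) (g ∘ px_hom (cp_inr S)) mm);
  rewrite comp_assoc, e, <- px_hom_comp.
- rewrite cp_copair_inl. reflexivity.
- rewrite cp_copair_inr. reflexivity.
Qed.

Lemma px_isPullback (P X Y Z : PXMod SA B) (f : X ~> Z) (g : Y ~> Z)
    (p : P ~> X) (q : P ~> Y) :
  IsPullback (px_hom f) (px_hom g) (px_hom p) (px_hom q) -> IsPullback f g p q.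
Proof.
intros H. split; [apply PXHom_eq; exact (proj1 H) |]. intros T x y e.
destruct (IsPullback_lift H (f_equal (@px_hom _ _ _ _ _) e)) as [u0 [e1 e2]].
destruct (px_hom_of_jointlyMonic (IsPullback_ext H) e1 e2) as [u eu].
subst u0. exists u. split; [split; apply PXHom_eq; assumption |].
intros v [e3 e4]. apply PXHom_eq. subst x y.
apply (IsPullback_ext H); assumption.
Qed.

Lemma px_pullback_exists (X Y Z : PXMod SA B) (f : X ~> Z) (g : Y ~> Z) :
  exists (P : PXMod SA B) (p : P ~> X) (q : P ~> Y),
    IsPullback (px_hom f) (px_hom g) (px_hom p) (px_hom q).
Proof.
pose (P := pullback SA (px_hom f) (px_hom g)).
assert (E : px_hom f ∘ (px_act X ∘ flat_map SA (idm B) (pb_fst P)) =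
  px_hom g ∘ (px_act Y ∘ flat_map SA (idm B) (pb_snd P))).
{ rewrite !comp_assoc, !px_hom_act, <- !comp_assoc, <- !flat_map_comp, pb_square.
  reflexivity. }
destruct (IsPullback_lift (pb_isPullback P) E) as [a [a1 a2]].
assert (Ha := jointlyMonic_isAction (@pb_ext _ _ _ _ _ _ P)
  (px_isAction X) (px_isAction Y) a1 a2).
assert (Hb : px_bd X ∘ pb_fst P ∘ a =
  conj_action SA B ∘ flat_map SA (idm B) (px_bd X ∘ pb_fst P)).
{ rewrite <- comp_assoc, a1, comp_assoc, px_precrossed, <- comp_assoc,
    <- flat_map_comp, comp_id_l. reflexivity. }
assert (Hq : px_bd Y ∘ pb_snd P = px_bd X ∘ pb_fst P).
{ rewrite <- (px_hom_bd f), <- (px_hom_bd g), <- !comp_assoc, pb_square.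
  reflexivity. }
pose (Q := {| px_ob := pb_ob P; px_bd := px_bd X ∘ pb_fst P; px_act := a;
  px_isAction := Ha; px_precrossed := Hb |} : PXMod SA B).
exists Q, (@Build_PXHom _ SA B Q X (pb_fst P) eq_refl a1),
  (@Build_PXHom _ SA B Q Y (pb_snd P) Hq a2).
exact (pb_isPullback P).
Qed.

(** The forgetful functor to [C] preserves pullbacks, as it does for the pullback
    constructed above. *)
Lemma px_pullback_underlying (P X Y Z : PXMod SA B) (f : X ~> Z) (g : Y ~> Z)
    (p : P ~> X) (q : P ~> Y) :
  IsPullback f g p q -> IsPullback (px_hom f) (px_hom g) (px_hom p) (px_hom q).
Proof.
intros H. destruct (px_pullback_exists f g) as [P0 [p0 [q0 H0]]].
assert (H0' := px_isPullback H0).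
destruct (IsPullback_lift H (proj1 H0')) as [u [up uq]].
destruct (IsPullback_lift H0' (proj1 H)) as [v [vp vq]].
assert (uv : u ∘ v = idm P).
{ apply (IsPullback_ext H); rewrite comp_assoc, comp_id_r, ?up, ?uq; assumption. }
split; [rewrite <- !px_hom_comp, (proj1 H); reflexivity |].
intros T x y e. destruct (IsPullback_lift H0 e) as [t [t1 t2]].
exists (px_hom u ∘ t). split.
- rewrite !comp_assoc, <- !px_hom_comp, up, uq. split; assumption.
- intros w [w1 w2].
  rewrite <- (comp_id_l w), <- px_hom_id, <- uv, px_hom_comp, <- comp_assoc.
  f_equal. apply (IsPullback_ext H0).
  + rewrite comp_assoc, <- px_hom_comp, vp, t1, w1. reflexivity.
  + rewrite comp_assoc, <- px_hom_comp, vq, t2, w2. reflexivity.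
Qed.

(** The image in [C] is stable under the action because [B♭(-)] preserves regular
    epimorphisms. *)
Lemma px_image (X Y : PXMod SA B) (f : X ~> Y) :
  exists (I : PXMod SA B) (e : X ~> I) (m : I ~> Y),
    IsRegularEpi (px_hom e) /\ IsMono (px_hom m) /\ m ∘ e = f.
Proof.
destruct (image_factorization SA (px_hom f)) as [I [e [m [re [mm em]]]]].
assert (E : m ∘ (e ∘ px_act X) =
  px_act Y ∘ flat_map SA (idm B) m ∘ flat_map SA (idm B) e).
{ rewrite comp_assoc, em, px_hom_act, <- comp_assoc, <- flat_map_comp, comp_id_l, em.
  reflexivity. }
destruct (regularEpi_fill (flat_map_regular_snd SA B re) mm E) as [a [ae ma]].
assert (Ha := sub_isAction mm (px_isAction Y) ma).
assert (Hb : px_bd Y ∘ m ∘ a = conj_action SA B ∘ flat_map SA (idm B) (px_bd Y ∘ m)).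
{ rewrite <- comp_assoc, ma, comp_assoc, px_precrossed, <- comp_assoc,
    <- flat_map_comp, comp_id_l. reflexivity. }
pose (J := {| px_ob := I; px_bd := px_bd Y ∘ m; px_act := a;
  px_isAction := Ha; px_precrossed := Hb |} : PXMod SA B).
assert (He : px_bd J ∘ e = px_bd X).
{ simpl. rewrite <- comp_assoc, em. apply px_hom_bd. }
exists J, (@Build_PXHom _ SA B X J e He (eq_sym ae)),
  (@Build_PXHom _ SA B J Y m eq_refl ma).
split; [exact re |]. split; [exact mm |]. apply PXHom_eq. exact em.
Qed.

(** A morphism that does not factor through a proper precrossed submodule is onto
    its image, hence a regular epimorphism in [C]. *)
Lemma px_extremal_regular (X Y : PXMod SA B) (f : X ~> Y) :
  (forall (I : PXMod SA B) (e : X ~> I) (m : I ~> Y),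
     IsMono (px_hom m) -> m ∘ e = f -> exists s : Y ~> I, m ∘ s = idm Y) ->
  IsRegularEpi (px_hom f).
Proof.
intros H. destruct (px_image f) as [I [e [m [re [mm em]]]]].
destruct (H I e m mm em) as [s es]. rewrite <- em, px_hom_comp.
apply regularEpi_iso_comp; [exact re |].
apply (iso_of_mono_section (s := px_hom s) mm).
rewrite <- px_hom_comp, es. reflexivity.
Qed.

Lemma px_regularEpi (X Y : PXMod SA B) (f : X ~> Y) :
  IsRegularEpi f -> IsRegularEpi (px_hom f).
Proof.
intros rf. apply px_extremal_regular. intros I e m mm em.
assert (pm : IsMono m).
{ intros T x y exy. apply PXHom_eq, mm. rewrite <- !px_hom_comp, exy. reflexivity. }
rewrite <- (comp_id_l f) in em.
destruct (regularEpi_fill rf pm em) as [s [_ es]]. exists s. exact es.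
Qed.

Lemma px_pushout_regular (W X Y Q : PXMod SA B) (f : W ~> X) (g : W ~> Y)
    (p : X ~> Q) (q : Y ~> Q) :
  IsPushout f g p q -> IsRegularEpi (px_hom f) -> IsRegularEpi (px_hom q).
Proof.
intros H rf. apply px_extremal_regular. intros I e m mm em.
assert (E : px_hom m ∘ (px_hom (e ∘ g)) = px_hom p ∘ px_hom f).
{ rewrite <- !px_hom_comp, comp_assoc, em, (proj1 H). reflexivity. }
destruct (regularEpi_fill rf mm E) as [w [wf mw]].
destruct (px_hom_of_mono mm mw) as [w' ew]. subst w.
destruct (@IsPushout_desc _ _ _ _ _ _ _ _ _ H I w' e) as [s [sp sq]].
{ apply PXHom_eq. exact wf. }
exists s. apply (IsPushout_ext H); rewrite <- comp_assoc, comp_id_l, ?sp, ?sq.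
- apply PXHom_eq. exact mw.
- exact em.
Qed.

End PXLimits.

(** * The Peiffer condition on a pair of morphisms *)

Section Peiffer.
Variables (C : Category) (SA : SemiAbelian C) (B : C).

(** In groups: [n y * m x * (n y)^-1 = m ((∂ y) · x)], so that the conjugation
    action of [Y] on [X] inside [A] is the one pulled back from [B]. *)
Definition PeifferActs (X Y A : PXMod SA B) (n : Y ~> A) (m : X ~> A) : Prop :=
  px_hom m ∘ pullback_action (px_bd Y) (px_act X) =
  copair SA (px_hom n) (px_hom m) ∘ flat_ker SA Y X.

(** The Peiffer condition for the object of arrows [H] over [Y], which acts on [X]
    through the codomain map and by conjugation in the object of arrows [G] over
    [A].  Unlike [PeifferActs] it also records how [B] acts, which makes the induced
    map out of the semidirect product a morphism of precrossed modules. *)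
Definition GraphActs (X Y A : PXMod SA B) (n : Y ~> A) (m : X ~> A) : Prop :=
  forall (H G : ReflGraph B) (l : px_ob Y ~> rg_ob H) (k : px_ob A ~> rg_ob G)
    (N : rg_ob H ~> rg_ob G),
    IsNormalization l -> IsNormalization k -> IsGraphMap N ->
    N ∘ l = k ∘ px_hom n ->
    k ∘ px_hom m ∘ pullback_action (rg_c H) (px_act X) =
    copair SA N (k ∘ px_hom m) ∘ flat_ker SA (rg_ob H) X.

Lemma pullback_action_natural (X X' : PXMod SA B) (a : X' ~> X)
    (D E : C) (v : D ~> B) (u : E ~> D) :
  px_hom a ∘ pullback_action (v ∘ u) (px_act X') =
  pullback_action v (px_act X) ∘ flat_map SA u (px_hom a).
Proof.
unfold pullback_action.
rewrite comp_assoc, px_hom_act, <- !comp_assoc, <- !flat_map_comp.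
rewrite !comp_id_l, comp_id_r. reflexivity.
Qed.

Lemma peifferActs_comp (X Y A X' Y' : PXMod SA B) (n : Y ~> A) (m : X ~> A)
    (b : Y' ~> Y) (a : X' ~> X) :
  PeifferActs n m -> PeifferActs (n ∘ b) (m ∘ a).
Proof.
unfold PeifferActs. intros e.
rewrite !px_hom_comp, <- (px_hom_bd b), <- comp_assoc, pullback_action_natural.
rewrite comp_assoc, e, <- comp_assoc, copair_flat_map. reflexivity.
Qed.

Lemma peifferActs_of_cover (X Y A X' Y' : PXMod SA B) (n : Y ~> A) (m : X ~> A)
    (b : Y' ~> Y) (a : X' ~> X) :
  IsRegularEpi (px_hom b) -> IsRegularEpi (px_hom a) ->
  PeifferActs (n ∘ b) (m ∘ a) -> PeifferActs n m.
Proof.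
unfold PeifferActs. intros rb ra e.
apply (regularEpi_epi (flat_map_regular SA rb ra)).
rewrite <- !comp_assoc, copair_flat_map, <- pullback_action_natural, px_hom_bd.
rewrite comp_assoc. exact e.
Qed.

Lemma peifferActs_post (X Y A A' : PXMod SA B) (n : Y ~> A) (m : X ~> A)
    (r : A ~> A') :
  PeifferActs n m -> PeifferActs (r ∘ n) (r ∘ m).
Proof.
unfold PeifferActs. intros e.
rewrite !px_hom_comp, <- comp_assoc, e, comp_assoc, comp_copair. reflexivity.
Qed.

Lemma peifferActs_of_jointlyMonic (X Y A U V : PXMod SA B) (n : Y ~> A) (m : X ~> A)
    (p : A ~> U) (q : A ~> V) :
  (forall (T : C) (x y : T ~> px_ob A),
     px_hom p ∘ x = px_hom p ∘ y -> px_hom q ∘ x = px_hom q ∘ y -> x = y) ->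
  PeifferActs (p ∘ n) (p ∘ m) -> PeifferActs (q ∘ n) (q ∘ m) -> PeifferActs n m.
Proof.
unfold PeifferActs. intros jm e1 e2.
rewrite !px_hom_comp, <- comp_copair, <- !comp_assoc in e1, e2.
apply jm; assumption.
Qed.

Lemma crossed_iff_peifferActs (X : PXMod SA B) :
  IsCrossed X <-> PeifferActs (idm X) (idm X).
Proof.
unfold IsCrossed, PeifferActs, conj_action. rewrite px_hom_id, comp_id_l.
reflexivity.
Qed.

Lemma crossed_peifferActs (X Y A : PXMod SA B) (n : Y ~> A) (m : X ~> A) :
  IsCrossed A -> PeifferActs n m.
Proof.
intros H. apply crossed_iff_peifferActs in H.
rewrite <- (comp_id_l n), <- (comp_id_l m). apply peifferActs_comp. exact H.
Qed.

(** [n = 0] forces [∂ = 0] on [Y], and then both sides are the trivial action. *)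
Lemma peifferActs_zero_l (X Y A : PXMod SA B) (n : Y ~> A) (m : X ~> A) :
  px_hom n = zmor SA Y A -> PeifferActs n m.
Proof.
intros en. unfold PeifferActs, pullback_action.
rewrite <- (px_hom_bd n), en, comp_zmor, flat_map_zmor_fst.
rewrite (comp_assoc (px_act X)), (proj1 (px_isAction X)), comp_id_l.
rewrite comp_assoc, comp_copair, comp_zmor, comp_id_r. reflexivity.
Qed.

Lemma peifferActs_zero_r (X Y A : PXMod SA B) (n : Y ~> A) (m : X ~> A) :
  px_hom m = zmor SA X A -> PeifferActs n m.
Proof.
intros em. unfold PeifferActs. rewrite em, zmor_comp.
symmetry. apply copair_zmor_flat_ker.
Qed.

Lemma graphActs_comp (X Y A X' : PXMod SA B) (n : Y ~> A) (m : X ~> A)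
    (a : X' ~> X) :
  GraphActs n m -> GraphActs n (m ∘ a).
Proof.
intros Hnm H G l k N Hl Hk HN e.
rewrite px_hom_comp, <- (comp_id_r (rg_c H)), comp_assoc.
rewrite <- (comp_assoc (k ∘ px_hom m)), pullback_action_natural.
rewrite (comp_assoc (k ∘ px_hom m)), (Hnm H G l k N Hl Hk HN e).
rewrite <- comp_assoc, copair_flat_map, comp_id_r. reflexivity.
Qed.

Lemma normalization_pullback_action (X : PXMod SA B) (G : ReflGraph B)
    (k : px_ob X ~> rg_ob G) (D : C) (u : D ~> B) : IsNormalization k ->
  k ∘ pullback_action u (px_act X) = copair SA (rg_e G ∘ u) k ∘ flat_ker SA D X.
Proof.
intros Hk. unfold pullback_action.
rewrite comp_assoc, (proj2 (proj2 (proj1 Hk))), <- comp_assoc, copair_flat_map,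
  comp_id_r. reflexivity.
Qed.

Lemma pullback_isAction (X : PXMod SA B) (D : C) (u : D ~> B) :
  IsAction (pullback_action u (px_act X)).
Proof.
destruct (normalization_of_px X) as [G [k Hk]].
exact (conjugation_isAction (IsKernel_mono (normalization_kernel Hk))
  (normalization_pullback_action u Hk)).
Qed.

(** When [X] is normal in the object of arrows over [A], the object of arrows
    over [Y] acts on [X] by conjugation.  This action and the one through the
    codomain map agree on [B], by equivariance, and on [Y], by the Peiffer
    condition; [B] and [Y] are jointly extremal epic, so (UA) identifies them. *)
Lemma graphActs_of_peifferActs (UA : ConditionUA SA) (X Y A : PXMod SA B)
    (n : Y ~> A) (m : X ~> A) :
  (forall (G : ReflGraph B) (k : px_ob A ~> rg_ob G), IsNormalization k ->
     exists (D : C) (g : rg_ob G ~> D), IsKernel SA (k ∘ px_hom m) g) ->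
  PeifferActs n m -> GraphActs n m.
Proof.
intros Hm Hnm H G l k N Hl Hk HN e.
destruct (Hm G k Hk) as [D [g Hg]].
destruct (conjugation_exists N Hg) as [al [Hal eal]].
assert (mk := IsKernel_mono Hg).
enough (E : pullback_action (rg_c H) (px_act X) = al) by (rewrite E; exact eal).
assert (E1 : al ∘ flat_map SA (rg_e H) (idm (px_ob X)) = px_act X).
{ apply mk. rewrite comp_assoc, eal, <- comp_assoc, copair_flat_map, comp_id_r.
  rewrite (proj1 HN), <- comp_assoc, px_hom_act, comp_assoc.
  rewrite (proj2 (proj2 (proj1 Hk))), <- comp_assoc, copair_flat_map, comp_id_r.
  reflexivity. }
assert (E2 : al ∘ flat_map SA l (idm (px_ob X)) =
  pullback_action (px_bd Y) (px_act X)).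
{ apply mk. rewrite comp_assoc, eal, <- comp_assoc, copair_flat_map, comp_id_r.
  rewrite e, <- comp_copair, <- !comp_assoc. f_equal. symmetry. exact Hnm. }
apply (UA _ _ _ _ _ (normalization_jointlyExtremal Hl) X (px_act X)
  (pullback_action (px_bd Y) (px_act X))).
- apply px_isAction.
- apply pullback_isAction.
- apply pullback_isAction.
- exact Hal.
- unfold pullback_action. rewrite <- comp_assoc, <- flat_map_comp, rg_ce, comp_id_l.
  rewrite flat_map_id. apply comp_id_r.
- symmetry. exact E1.
- unfold pullback_action. rewrite <- comp_assoc, <- flat_map_comp, <- (proj2 Hl).
  rewrite comp_id_l. reflexivity.
- symmetry. exact E2.
Qed.

Lemma peifferActs_of_semidirect (X Y A : PXMod SA B) (n : Y ~> A) (m : X ~> A)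
    (S : PXSemidirect X Y) (h : sd_ob S ~> A) :
  h ∘ sd_j S = m -> h ∘ sd_i S = n -> PeifferActs n m.
Proof.
intros <- <-. unfold PeifferActs.
rewrite !px_hom_comp, <- comp_copair, <- !comp_assoc. f_equal.
exact (proj2 (proj2 (sd_point S))).
Qed.

(** The composite graph is the semidirect product of [X] with the object of
    arrows over [Y], for the action through the codomain map. *)
Lemma semidirect_desc (X Y A : PXMod SA B) (n : Y ~> A) (m : X ~> A)
    (S : PXSemidirect X Y) : GraphActs n m ->
  exists h : sd_ob S ~> A, h ∘ sd_j S = m /\ h ∘ sd_i S = n.
Proof.
intros Hnm.
destruct S as [S j i p Hp X1 kX HX Y1 kY HY k HS j1 j2 i1 i2]. cbn [sd_ob sd_j sd_i].
change (comp_fst SA X1 Y1 ∘ (k ∘ px_hom j) = kX) in j1.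
change (comp_snd SA X1 Y1 ∘ (k ∘ px_hom j) = zmor SA X Y1) in j2.
change (comp_fst SA X1 Y1 ∘ (k ∘ px_hom i) = rg_e X1 ∘ px_bd Y) in i1.
change (comp_snd SA X1 Y1 ∘ (k ∘ px_hom i) = kY) in i2.
destruct (normalization_of_px A) as [A1 [kA HA]].
destruct (normalization_desc n HY HA) as [N [HN eN]].
assert (eq := Hnm Y1 A1 kY kA N HY HA HN eN).
destruct (comp_inclusions SA X1 Y1) as [FX [FY [_ [GY [_ [_ [FY1 FY2]]]]]]].
assert (Hj : IsKernel SA (k ∘ px_hom j) (comp_snd SA X1 Y1)).
{ exact (pullback_kernel (IsPullback_sym (comp_isPullback SA X1 Y1))
    (normalization_kernel HX) j2 j1). }
assert (Hsd : IsSemidirect (pullback_action (rg_c Y1) (px_act X))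
  (comp_snd SA X1 Y1) FY (k ∘ px_hom j)).
{ split; [exact FY2 |]. split; [exact Hj |].
  apply (IsPullback_ext (comp_isPullback SA X1 Y1));
    rewrite !comp_assoc, comp_copair, <- (comp_assoc _ k).
  - rewrite j1, FY1. apply (normalization_pullback_action _ HX).
  - rewrite j2, FY2, zmor_comp. symmetry. apply copair_zmor_flat_ker. }
assert (je := IsSemidirect_jointlyExtremal Hsd).
destruct (IsSemidirect_desc (pullback_isAction _ _) Hsd eq) as [M [M1 M2]].
assert (HM : IsGraphMap M).
{ split; [| split].
  - rewrite <- (proj1 GY), comp_assoc, M1. exact (proj1 HN).
  - apply (jointlyExtremal_epi SA je); rewrite <- comp_assoc.
    + rewrite M1, (proj1 (proj2 GY)). exact (proj1 (proj2 HN)).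
    + rewrite M2, comp_assoc, (proj1 (normalization_kernel HA)), zmor_comp.
      rewrite comp_d, <- comp_assoc, j2, comp_zmor. reflexivity.
  - apply (jointlyExtremal_epi SA je); rewrite <- comp_assoc.
    + rewrite M1, (proj2 (proj2 GY)). exact (proj2 (proj2 HN)).
    + rewrite M2, comp_assoc, <- (proj2 HA), px_hom_bd.
      rewrite comp_c, <- comp_assoc, j1. exact (proj2 HX). }
destruct (normalization_lift HS HA HM) as [h eh].
exists h. split; apply PXHom_eq, (IsKernel_mono (normalization_kernel HA));
  rewrite px_hom_comp, comp_assoc, eh, <- comp_assoc.
- exact M2.
- rewrite <- eN, <- M1, <- comp_assoc. f_equal.
  apply (IsPullback_ext (comp_isPullback SA X1 Y1)); rewrite (comp_assoc _ FY).
  + rewrite i1, FY1, <- comp_assoc, <- (proj2 HY). reflexivity.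
  + rewrite i2, FY2, comp_id_l. reflexivity.
Qed.

(** * The Peiffer commutator *)

Lemma semidirect_copair_regular (X Y : PXMod SA B) (S : PXSemidirect X Y)
    (K : Coproduct X Y) : IsRegularEpi (px_hom (cp_copair K (sd_j S) (sd_i S))).
Proof.
apply px_copair_regular, jointlyExtremal_sym.
exact (IsSemidirect_jointlyExtremal (sd_point S)).
Qed.

Lemma semidirect_copair_regular' (X Y : PXMod SA B) (S : PXSemidirect Y X)
    (K : Coproduct X Y) : IsRegularEpi (px_hom (cp_copair K (sd_i S) (sd_j S))).
Proof.
apply px_copair_regular. exact (IsSemidirect_jointlyExtremal (sd_point S)).
Qed.

(** If [g] kills the kernel of [s ∘ e], it kills the smaller kernel of [e], of which
    [e] is the cokernel. *)
Lemma px_desc_of_kernel (W X Q A : PXMod SA B) (e : W ~> X) (s : X ~> Q)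
    (g : W ~> A) :
  IsRegularEpi (px_hom e) ->
  px_hom g ∘ kerm SA (px_hom (s ∘ e)) = zmor SA (ker SA (px_hom (s ∘ e))) A ->
  exists h : X ~> A, h ∘ e = g.
Proof.
intros re eg.
destruct (IsKernel_lift (kerm_isKernel SA (px_hom (s ∘ e)))
  (t := kerm SA (px_hom e))) as [u eu].
{ rewrite px_hom_comp, <- comp_assoc, kerm_zero. apply comp_zmor. }
destruct (@regularEpi_cokernel _ SA _ _ _ _ _ _ (px_hom g) re
  (kerm_isKernel SA (px_hom e))) as [h eh].
{ rewrite <- eu, comp_assoc, eg. apply zmor_comp. }
destruct (px_hom_of_regularEpi re eh) as [h' eh']. subst h.
exists h'. apply PXHom_eq. exact eh.
Qed.

(** An initial image means that [[m, n]] kills the kernel of the diagonal, which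
    contains the kernels of both maps to the semidirect products. *)
Lemma semidirects_of_commutatorIsZero (X Y A : PXMod SA B) (m : X ~> A) (n : Y ~> A) :
  PeifferCommutatorIsZero m n ->
  (exists (S : PXSemidirect X Y) (h : sd_ob S ~> A),
     h ∘ sd_j S = m /\ h ∘ sd_i S = n) /\
  (exists (S : PXSemidirect Y X) (h : sd_ob S ~> A),
     h ∘ sd_j S = n /\ h ∘ sd_i S = m).
Proof.
intros [H [h [[P [_ [e [_ eh]]]] HI]]].
pose (g := cp_copair (pp_coproduct P) m n).
assert (z : px_hom g ∘ kerm SA (px_hom (pp_diag P)) =
  zmor SA (ker SA (px_hom (pp_diag P))) A).
{ destruct (HI (px_zero SA B)) as [a [_ _]].
  destruct (px_zero_initial A) as [b [_ _]].
  destruct (HI A) as [c [_ Hc]].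
  assert (E : h = b ∘ a) by (rewrite <- (Hc h I), <- (Hc (b ∘ a) I); reflexivity).
  change (px_hom (g ∘ px_kerm (pp_diag P)) = zmor SA (ker SA (px_hom (pp_diag P))) A).
  unfold g. rewrite <- eh, E, !px_hom_comp.
  unfold zmor. rewrite <- comp_assoc. f_equal; [apply from_zero_unique |].
  apply to_zero_unique. }
split.
- destruct (px_desc_of_kernel (s := po_fst (pp_pushout P))
    (semidirect_copair_regular (pp_XY P) (pp_coproduct P)) z) as [u eu].
  exists (pp_XY P), u. unfold g in eu.
  split.
  + transitivity (cp_copair (pp_coproduct P) m n ∘ cp_inl (pp_coproduct P));
      [rewrite <- eu, <- comp_assoc |]; rewrite cp_copair_inl; reflexivity.
  + transitivity (cp_copair (pp_coproduct P) m n ∘ cp_inr (pp_coproduct P));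
      [rewrite <- eu, <- comp_assoc |]; rewrite cp_copair_inr; reflexivity.
- unfold pp_diag in z.
  rewrite (proj1 (po_isPushout (pp_pushout P))) in z.
  destruct (px_desc_of_kernel (s := po_snd (pp_pushout P))
    (semidirect_copair_regular' (pp_YX P) (pp_coproduct P)) z) as [u eu].
  exists (pp_YX P), u. unfold g in eu.
  split.
  + transitivity (cp_copair (pp_coproduct P) m n ∘ cp_inr (pp_coproduct P));
      [rewrite <- eu, <- comp_assoc |]; rewrite cp_copair_inr; reflexivity.
  + transitivity (cp_copair (pp_coproduct P) m n ∘ cp_inl (pp_coproduct P));
      [rewrite <- eu, <- comp_assoc |]; rewrite cp_copair_inl; reflexivity.
Qed.

Lemma commutatorIsZero_of_graphActs (X Y A : PXMod SA B) (m : X ~> A) (n : Y ~> A) :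
  GraphActs n m -> GraphActs m n -> PeifferCommutatorIsZero m n.
Proof.
intros Hnm Hmn.
destruct (px_coproduct_exists X Y) as [K].
destruct (px_semidirect_exists X Y) as [S].
destruct (px_semidirect_exists Y X) as [S'].
destruct (px_pushout_exists (cp_copair K (sd_j S) (sd_i S))
  (cp_copair K (sd_i S') (sd_j S'))) as [Q [p [q HQ]]].
pose (P := {| pp_coproduct := K; pp_XY := S; pp_YX := S';
  pp_pushout := Build_Pushout HQ |}).
destruct (semidirect_desc S Hnm) as [h [h1 h2]].
destruct (semidirect_desc S' Hmn) as [h' [h1' h2']].
assert (E : h ∘ cp_copair K (sd_j S) (sd_i S) =
  h' ∘ cp_copair K (sd_i S') (sd_j S')).
{ apply (cp_ext (S := K)); rewrite <- !comp_assoc.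
  - rewrite !cp_copair_inl, h1, h2'. reflexivity.
  - rewrite !cp_copair_inr, h2, h1'. reflexivity. }
destruct (IsPushout_desc HQ E) as [t [t1 _]].
assert (eg : cp_copair K m n = t ∘ pp_diag P).
{ change (pp_diag P) with (p ∘ cp_copair K (sd_j S) (sd_i S)).
  rewrite comp_assoc, t1. apply (cp_ext (S := K)); rewrite <- comp_assoc.
  - rewrite !cp_copair_inl. symmetry. exact h1.
  - rewrite !cp_copair_inr. symmetry. exact h2. }
pose (D := px_ker (pp_diag P)).
destruct (px_zero_initial A) as [z [_ _]].
(* [D] has zero structure map, so it carries a zero endomorphism, and the map to
   the zero object is the coequalizer of that endomorphism with the identity. *)
assert (E2 : to_zero SA D ∘ px_act D =
  px_act (px_zero SA B) ∘ flat_map SA (idm B) (to_zero SA D)) by apply to_zero_unique.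
pose (e := @Build_PXHom _ SA B D (px_zero SA B) (to_zero SA D) eq_refl E2).
destruct (px_zero_initial D) as [o [_ _]].
exists (px_zero SA B), z. split; [| apply px_zero_initial].
exists P. split.
- intros T x y _. apply PXHom_eq, to_zero_unique.
- exists e. split.
  + apply (regularEpi_of_section (s := o)).
    apply PXHom_eq, to_zero_unique.
  + apply PXHom_eq. simpl. rewrite (f_equal (@px_hom _ _ _ _ _) eg).
    rewrite px_hom_comp, <- comp_assoc, kerm_zero, comp_zmor.
    unfold zmor. f_equal. apply from_zero_unique.
Qed.

End Peiffer.

(** * The reflection onto crossed modules *)

Section Reflection.
Variables (C : Category) (SA : SemiAbelian C) (UA : ConditionUA SA) (B : C).

(** The reflection is the universal quotient [q] of [X] such that [[q, q]] factors
    through the semidirect product of [X] with itself.  Such a factorization gives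
    the Peiffer condition on [q].  A morphism from [X] to a crossed module [Z] has
    such a factorization by (UA), because [Z] is normal in its object of arrows. *)
Lemma reflection_exists (X : PXMod SA B) :
  exists (GX : PXMod SA B) (eta : X ~> GX),
    IsReflection eta /\ IsRegularEpi (px_hom eta).
Proof.
destruct (px_coproduct_exists X X) as [K].
destruct (px_semidirect_exists X X) as [S].
destruct (px_pushout_exists (cp_copair K (sd_j S) (sd_i S))
  (cp_copair K (idm X) (idm X))) as [Q [p [q HQ]]].
assert (rq := px_pushout_regular HQ (semidirect_copair_regular S K)).
exists Q, q. split; [| exact rq]. split.
- apply crossed_iff_peifferActs. apply (peifferActs_of_cover (b:=q) (a:=q) rq rq).
  rewrite comp_id_l.
  apply (peifferActs_of_semidirect (S := S) (h := p)).
  + rewrite <- (cp_copair_inl K (sd_j S) (sd_i S)), comp_assoc, (proj1 HQ).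
    rewrite <- comp_assoc, cp_copair_inl. apply comp_id_r.
  + rewrite <- (cp_copair_inr K (sd_j S) (sd_i S)), comp_assoc, (proj1 HQ).
    rewrite <- comp_assoc, cp_copair_inr. apply comp_id_r.
- intros Z g HZ.
  assert (Hg : GraphActs g g).
  { rewrite <- (comp_id_l g) at 2. apply graphActs_comp.
    apply (graphActs_of_peifferActs UA).
    - intros G k Hk. exists B, (rg_d G). rewrite px_hom_id, comp_id_r.
      exact (normalization_kernel Hk).
    - apply crossed_peifferActs. exact HZ. }
  destruct (semidirect_desc S Hg) as [h [h1 h2]].
  destruct (IsPushout_desc HQ (x := h) (y := g)) as [u [_ uq]].
  { apply (cp_ext (S := K)); rewrite <- !comp_assoc.
    - rewrite !cp_copair_inl, comp_id_r. exact h1.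
    - rewrite !cp_copair_inr, comp_id_r. exact h2. }
  exists u. split; [exact uq |]. intros v vq. apply PXHom_eq.
  apply (regularEpi_epi rq). rewrite <- !px_hom_comp, uq, vq. reflexivity.
Qed.

End Reflection.

(** * Products with an object on which the structure map vanishes *)

Section Times.
Variables (C : Category) (SA : SemiAbelian C) (B : C).

Section TimesObject.
Variables K X : PXMod SA B.

Definition times_act : flat SA B (prod SA K X) ~> prod SA K X :=
  pair SA (px_act K ∘ flat_map SA (idm B) (pr1 SA K X))
    (px_act X ∘ flat_map SA (idm B) (pr2 SA K X)).

Lemma times_isAction : IsAction times_act.
Proof.
apply (@jointlyMonic_isAction _ SA _ _ _ _ (pr1 SA K X) (pr2 SA K X)
  (px_act K) (px_act X)).
- intros T x y. apply prod_ext.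
- apply px_isAction.
- apply px_isAction.
- apply pr1_pair.
- apply pr2_pair.
Qed.

Lemma times_precrossed :
  px_bd X ∘ pr2 SA K X ∘ times_act =
  conj_action SA B ∘ flat_map SA (idm B) (px_bd X ∘ pr2 SA K X).
Proof.
unfold times_act. rewrite <- comp_assoc, pr2_pair, comp_assoc, px_precrossed.
rewrite <- comp_assoc, <- flat_map_comp, comp_id_l. reflexivity.
Qed.

(** The product of the [B]-actions, with the structure map of [X].  This is not
    the product of precrossed modules; for [px_bd K = 0] it is the semidirect
    product of [X] and [K], because [K] then acts trivially on [X]. *)
Definition times : PXMod SA B := {|
  px_ob := prod SA K X;
  px_bd := px_bd X ∘ pr2 SA K X;
  px_act := times_act;
  px_isAction := times_isAction;
  px_precrossed := times_precrossed
|}.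

(** The product data, typed by [times] so that they compose with its structure
    without unfolding it. *)
Definition tfst : px_ob times ~> px_ob K := pr1 SA K X.
Definition tsnd : px_ob times ~> px_ob X := pr2 SA K X.
Definition tpair (T : C) (x : T ~> px_ob K) (y : T ~> px_ob X) :
  T ~> px_ob times := pair SA x y.

Lemma tfst_pair (T : C) (x : T ~> px_ob K) (y : T ~> px_ob X) :
  tfst ∘ tpair x y = x.
Proof. apply pr1_pair. Qed.

Lemma tsnd_pair (T : C) (x : T ~> px_ob K) (y : T ~> px_ob X) :
  tsnd ∘ tpair x y = y.
Proof. apply pr2_pair. Qed.

Lemma times_ext (T : C) (x y : T ~> px_ob times) :
  tfst ∘ x = tfst ∘ y -> tsnd ∘ x = tsnd ∘ y -> x = y.
Proof. apply prod_ext. Qed.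

Lemma times_snd_act :
  tsnd ∘ px_act times = px_act X ∘ flat_map SA (idm B) (tsnd).
Proof. apply pr2_pair. Qed.

Lemma times_fst_act :
  tfst ∘ px_act times = px_act K ∘ flat_map SA (idm B) (tfst).
Proof. apply pr1_pair. Qed.

Definition times_snd : times ~> X := @Build_PXHom _ SA B times X (tsnd)
  eq_refl times_snd_act.

Definition incl1 : px_ob K ~> px_ob times := tpair (idm (px_ob K)) (zmor SA K X).
Definition incl2 : px_ob X ~> px_ob times := tpair (zmor SA X K) (idm (px_ob X)).

Lemma times_hom_intro (T : PXMod SA B) (u : px_ob T ~> px_ob times) :
  px_bd X ∘ (tsnd ∘ u) = px_bd T ->
  tfst ∘ u ∘ px_act T = px_act K ∘ flat_map SA (idm B) (tfst ∘ u) ->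
  tsnd ∘ u ∘ px_act T = px_act X ∘ flat_map SA (idm B) (tsnd ∘ u) ->
  exists u' : T ~> times, px_hom u' = u.
Proof.
intros e0 e1 e2.
assert (E0 : px_bd times ∘ u = px_bd T) by (rewrite <- e0; symmetry; apply comp_assoc).
assert (E : u ∘ px_act T = px_act times ∘ flat_map SA (idm B) u).
{ apply times_ext; rewrite !comp_assoc.
  - rewrite times_fst_act, <- (comp_assoc (px_act K)), <- flat_map_comp, comp_id_l.
    exact e1.
  - rewrite times_snd_act, <- (comp_assoc (px_act X)), <- flat_map_comp, comp_id_l.
    exact e2. }
exists (Build_PXHom E0 E). reflexivity.
Qed.

Lemma times_incl2 : exists i : X ~> times, px_hom i = incl2.
Proof.
apply times_hom_intro; unfold incl2; rewrite ?tfst_pair, ?tsnd_pair.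
- apply comp_id_r.
- rewrite zmor_comp, flat_map_zmor, comp_zmor. reflexivity.
- rewrite flat_map_id, comp_id_l, comp_id_r. reflexivity.
Qed.

Lemma incl2_kernel : IsKernel SA incl2 (tfst).
Proof.
apply IsKernel_intro.
- intros T x y exy. rewrite <- (comp_id_l x), <- (comp_id_l y).
  rewrite <- (tsnd_pair (zmor SA X K) (idm (px_ob X))), <- !comp_assoc.
  f_equal. exact exy.
- apply tfst_pair.
- intros T t et. exists (tsnd ∘ t). unfold incl2.
  apply times_ext; rewrite comp_assoc.
  + rewrite tfst_pair, zmor_comp. symmetry. exact et.
  + rewrite tsnd_pair. apply comp_id_l.
Qed.

Lemma incl1_kernel : IsKernel SA incl1 (tsnd).
Proof.
apply IsKernel_intro.
- intros T x y exy. rewrite <- (comp_id_l x), <- (comp_id_l y).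
  rewrite <- (tfst_pair (idm (px_ob K)) (zmor SA K X)), <- !comp_assoc.
  f_equal. exact exy.
- apply tsnd_pair.
- intros T t et. exists (tfst ∘ t). unfold incl1.
  apply times_ext; rewrite comp_assoc.
  + rewrite tfst_pair. apply comp_id_l.
  + rewrite tsnd_pair, zmor_comp. symmetry. exact et.
Qed.

Lemma incl_jointlyExtremal : IsJointlyExtremalEpi incl1 incl2.
Proof. exact (point_jointlyExtremal (tfst_pair _ _) incl2_kernel). Qed.

(** As [px_bd K = 0], the codomain and domain maps of the graph of [K] agree, so
    both projections of the composite graph restrict to kernels of domain maps.
    Together they are a morphism of points over [K] with the same kernel [X]. *)
Lemma times_of_semidirect (S : PXSemidirect X K) : px_bd K = zmor SA K B ->
  exists t : sd_ob S ~> times,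
    px_hom t ∘ px_hom (sd_j S) = incl2 /\ px_hom t ∘ px_hom (sd_i S) = incl1 /\
    IsIso (px_hom t).
Proof.
intros hK.
destruct S as [S j i p Hp X1 kX HX K1 kK HK k HS j1 j2 i1 i2].
cbn [sd_ob sd_j sd_i].
change (comp_fst SA X1 K1 ∘ (k ∘ px_hom j) = kX) in j1.
change (comp_snd SA X1 K1 ∘ (k ∘ px_hom j) = zmor SA X K1) in j2.
change (comp_fst SA X1 K1 ∘ (k ∘ px_hom i) = rg_e X1 ∘ px_bd K) in i1.
change (comp_snd SA X1 K1 ∘ (k ∘ px_hom i) = kK) in i2.
assert (mK := IsKernel_mono (normalization_kernel HK)).
assert (mX := IsKernel_mono (normalization_kernel HX)).
assert (zc : rg_c K1 = rg_d K1).
{ apply (jointlyExtremal_epi SA (normalization_jointlyExtremal HK)).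
  - rewrite rg_de, rg_ce. reflexivity.
  - rewrite <- (proj2 HK), hK. symmetry. exact (proj1 (normalization_kernel HK)). }
assert (dS : rg_d K1 ∘ (comp_snd SA X1 K1 ∘ k) = zmor SA S B).
{ rewrite comp_assoc, <- comp_d. exact (proj1 (normalization_kernel HS)). }
destruct (IsKernel_lift (normalization_kernel HK) dS) as [a ea].
destruct (IsKernel_lift (normalization_kernel HX) (t := comp_fst SA X1 K1 ∘ k))
  as [b eb].
{ rewrite comp_assoc, (proj1 (comp_isPullback SA X1 K1)), zc, <- comp_assoc.
  exact dS. }
assert (aj : a ∘ px_hom j = zmor SA X K).
{ apply mK. rewrite comp_assoc, ea, <- comp_assoc, j2, comp_zmor. reflexivity. }
assert (ai : a ∘ px_hom i = idm (px_ob K)).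
{ apply mK. rewrite comp_assoc, ea, <- comp_assoc, i2, comp_id_r. reflexivity. }
assert (bj : b ∘ px_hom j = idm (px_ob X)).
{ apply mX. rewrite comp_assoc, eb, <- comp_assoc, j1, comp_id_r. reflexivity. }
assert (bi : b ∘ px_hom i = zmor SA K X).
{ apply mX. rewrite comp_assoc, eb, <- comp_assoc, i1, hK, !comp_zmor. reflexivity. }
assert (eS := proj2 (proj2 (proj1 HS))).
destruct (@times_hom_intro S (tpair a b)) as [t et]; rewrite ?tfst_pair, ?tsnd_pair.
- rewrite (proj2 HX), <- comp_assoc, eb, comp_assoc, <- comp_c. symmetry.
  exact (proj2 HS).
- apply mK. rewrite !comp_assoc, ea, <- comp_assoc, eS, comp_assoc, comp_copair.
  rewrite (proj2 (proj2 (proj1 HK))), <- (comp_assoc (copair SA _ _)).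
  rewrite copair_flat_map, comp_snd_unit, comp_id_r, ea. reflexivity.
- apply mX. rewrite !comp_assoc, eb, <- comp_assoc, eS, comp_assoc, comp_copair.
  rewrite (proj2 (proj2 (proj1 HX))), <- (comp_assoc (copair SA _ _)).
  rewrite copair_flat_map, comp_fst_unit, comp_id_r, eb. reflexivity.
- exists t. rewrite et.
  assert (tj : tpair a b ∘ px_hom j = incl2).
  { unfold incl2. apply times_ext; rewrite comp_assoc, ?tfst_pair, ?tsnd_pair; assumption. }
  assert (ti : tpair a b ∘ px_hom i = incl1).
  { unfold incl1. apply times_ext; rewrite comp_assoc, ?tfst_pair, ?tsnd_pair; assumption. }
  split; [exact tj |]. split; [exact ti |].
  assert (pa : p = a).
  { apply (jointlyExtremal_epi SA (IsSemidirect_jointlyExtremal Hp)).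
    - rewrite ai. exact (proj1 Hp).
    - rewrite aj. exact (proj1 (proj1 (proj2 Hp))). }
  apply (@point_iso _ SA _ _ _ _ a (px_hom i) (tfst) incl1 _ (px_hom j)).
  + exact ai.
  + apply tfst_pair.
  + apply tfst_pair.
  + exact ti.
  + rewrite <- pa. exact (proj1 (proj2 Hp)).
  + rewrite tj. exact incl2_kernel.
Qed.

End TimesObject.

Section TimesMap.
Variables (K X Y : PXMod SA B) (g : X ~> Y).

Lemma times_map_exists : exists G : times K X ~> times K Y,
  tfst K Y ∘ px_hom G = tfst K X /\
  tsnd K Y ∘ px_hom G = px_hom g ∘ tsnd K X.
Proof.
destruct (@times_hom_intro K Y (times K X)
  (tpair (tfst K X) (px_hom g ∘ tsnd K X))) as [G eG];
  rewrite ?tfst_pair, ?tsnd_pair.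
- rewrite comp_assoc, px_hom_bd. reflexivity.
- apply times_fst_act.
- rewrite <- comp_assoc, times_snd_act, comp_assoc, px_hom_act, <- comp_assoc.
  rewrite <- flat_map_comp, comp_id_l. reflexivity.
- exists G. rewrite eG. split; [apply tfst_pair | apply tsnd_pair].
Qed.

Lemma times_map_pullback (G : times K X ~> times K Y) :
  tfst K Y ∘ px_hom G = tfst K X ->
  tsnd K Y ∘ px_hom G = px_hom g ∘ tsnd K X ->
  IsPullback (px_hom g) (tsnd K Y) (tsnd K X) (px_hom G).
Proof.
intros e1 e2. split; [symmetry; exact e2 |].
intros T x y exy. exists (tpair (tfst K Y ∘ y) x). split; [split |].
- apply tsnd_pair.
- apply times_ext; rewrite comp_assoc.
  + rewrite e1. apply tfst_pair.
  + rewrite e2, <- comp_assoc, tsnd_pair. exact exy.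
- intros v [<- <-]. apply times_ext.
  + rewrite tfst_pair, comp_assoc, e1. reflexivity.
  + rewrite tsnd_pair. reflexivity.
Qed.

End TimesMap.

(** Componentwise: conjugation of [(k, g)] on [(k', g')] has second component the
    one of the crossed module [X], and first component [k'], which is also
    [∂ g · k'] by the second hypothesis. *)
Lemma times_crossed (K X : PXMod SA B) : IsCrossed X ->
  conj_action SA K =
    copair SA (zmor SA K K) (idm (px_ob K)) ∘ flat_ker SA K K ->
  pullback_action (px_bd X) (px_act K) =
    copair SA (zmor SA X K) (idm (px_ob K)) ∘ flat_ker SA X K ->
  IsCrossed (times K X).
Proof.
intros HX HK HXK. unfold IsCrossed.
change (pullback_action (px_bd X ∘ tsnd K X) (px_act (times K X)) =
  conj_action SA (px_ob (times K X))).
set (p1 := tfst K X). set (p2 := tsnd K X).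
apply times_ext; fold p1 p2.
- transitivity (copair SA (zmor SA (px_ob (times K X)) K) p1 ∘
    flat_ker SA (px_ob (times K X)) (px_ob (times K X))).
  + transitivity (pullback_action (px_bd X) (px_act K) ∘ flat_map SA p2 p1).
    * unfold pullback_action. rewrite comp_assoc. unfold p1 at 1.
      rewrite times_fst_act, <- !comp_assoc, <- !flat_map_comp.
      rewrite !comp_id_l, comp_id_r. reflexivity.
    * rewrite HXK, <- comp_assoc, copair_flat_map, zmor_comp, comp_id_l. reflexivity.
  + transitivity (conj_action SA K ∘ flat_map SA p1 p1).
    * rewrite HK, <- comp_assoc, copair_flat_map, zmor_comp, comp_id_l. reflexivity.
    * unfold conj_action.
      rewrite <- comp_assoc, copair_flat_map, comp_assoc, comp_copair.
      rewrite !comp_id_l, !comp_id_r. reflexivity.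
- transitivity (pullback_action (px_bd X) (px_act X) ∘ flat_map SA p2 p2).
  + unfold pullback_action. rewrite comp_assoc. unfold p2 at 1.
    rewrite times_snd_act, <- !comp_assoc, <- !flat_map_comp.
    rewrite !comp_id_l, comp_id_r. reflexivity.
  + rewrite HX. unfold conj_action.
    rewrite <- comp_assoc, copair_flat_map, comp_assoc, comp_copair.
    rewrite !comp_id_l, !comp_id_r. reflexivity.
Qed.

(** A morphism from [K × X] to a crossed module kills the kernel of [1 × eta],
    because that kernel lies in [X]. *)
Lemma times_reflection (K X GX : PXMod SA B) (eta : X ~> GX)
    (G : times K X ~> times K GX) :
  IsReflection eta -> IsRegularEpi (px_hom eta) -> IsCrossed (times K GX) ->
  tfst K GX ∘ px_hom G = tfst K X ->
  tsnd K GX ∘ px_hom G = px_hom eta ∘ tsnd K X ->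
  IsReflection G.
Proof.
intros [_ H] reta Hc e1 e2. split; [exact Hc |]. intros Z g HZ.
assert (rG : IsRegularEpi (px_hom G)).
{ exact (regularEpi_pullback SA (times_map_pullback e1 e2) reta). }
destruct (times_incl2 K X) as [i ei].
destruct (H Z (g ∘ i) HZ) as [h [eh _]].
destruct (@regularEpi_cokernel _ SA _ _ _ _ _ _ (px_hom g) rG
  (kerm_isKernel SA (px_hom G))) as [u eu].
{ set (k := kerm SA (px_hom G)).
  assert (kz := kerm_zero SA (px_hom G)). fold k in kz.
  assert (k1 : tfst K X ∘ k = zmor SA (ker SA (px_hom G)) K).
  { rewrite <- e1, <- comp_assoc, kz. apply comp_zmor. }
  assert (k2 : px_hom eta ∘ (tsnd K X ∘ k) = zmor SA (ker SA (px_hom G)) GX).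
  { rewrite comp_assoc, <- e2, <- comp_assoc, kz. apply comp_zmor. }
  assert (ek : k = px_hom i ∘ (tsnd K X ∘ k)).
  { rewrite ei. unfold incl2. apply times_ext; rewrite (comp_assoc _ (tpair _ _)).
    - rewrite tfst_pair, zmor_comp. exact k1.
    - rewrite tsnd_pair, comp_id_l. reflexivity. }
  rewrite ek, comp_assoc, <- px_hom_comp, <- eh, px_hom_comp, <- comp_assoc, k2.
  apply comp_zmor. }
destruct (px_hom_of_regularEpi rG eu) as [u' eu']. subst u.
exists u'. split; [apply PXHom_eq; exact eu |].
intros v ev. apply PXHom_eq, (regularEpi_epi rG).
rewrite eu, <- ev. reflexivity.
Qed.

End Times.

(** * Central extensions *)

Section Central.
Variables (C : Category) (SA : SemiAbelian C) (UA : ConditionUA SA) (B : C).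
Variables (X Y : PXMod SA B) (f : X ~> Y).

(** The Peiffer conditions hold in the pullback [P] of a trivial extension because
    the kernel vanishes in the base and the reflection is crossed; they descend
    along the regular epimorphism [r]. *)
Lemma peifferActs_of_central : IsCentralExtension f ->
  PeifferActs (px_kerm f) (idm X) /\ PeifferActs (idm X) (px_kerm f).
Proof.
intros [Z [p [rp [P [q [r [Hpb [_ [GP [GZ [eP [eZ [Gq [HP [_ HG]]]]]]]]]]]]]]].
assert (rr : IsRegularEpi (px_hom r)).
{ exact (regularEpi_pullback SA (px_pullback_underlying Hpb) (px_regularEpi rp)). }
assert (jm := IsPullback_ext (px_pullback_underlying HG)).
assert (Z1 : px_bd Z ∘ zmor SA (px_ker f) Z = px_bd (px_ker f)) by apply comp_zmor.
assert (Z2 : zmor SA (px_ker f) Z ∘ px_act (px_ker f) =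
  px_act Z ∘ flat_map SA (idm B) (zmor SA (px_ker f) Z)).
{ rewrite zmor_comp, flat_map_zmor, comp_zmor. reflexivity. }
pose (z := Build_PXHom Z1 Z2 : px_ker f ~> Z).
destruct (IsPullback_lift Hpb (x := z) (y := px_kerm f)) as [k [k1 k2]].
{ apply PXHom_eq. simpl. rewrite comp_zmor, kerm_zero. reflexivity. }
assert (zk : px_hom (q ∘ k) = zmor SA (px_ker f) Z) by (rewrite k1; reflexivity).
assert (A1 : PeifferActs k (idm P)).
{ apply (peifferActs_of_jointlyMonic jm).
  - apply peifferActs_zero_l. exact zk.
  - apply crossed_peifferActs. exact (proj1 HP). }
assert (A2 : PeifferActs (idm P) k).
{ apply (peifferActs_of_jointlyMonic jm).
  - apply peifferActs_zero_r. exact zk.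
  - apply crossed_peifferActs. exact (proj1 HP). }
assert (ri : IsRegularEpi (px_hom (idm (px_ker f)))).
{ apply (regularEpi_of_section (s := idm _)). apply comp_id_l. }
apply (peifferActs_post r) in A1, A2. rewrite k2, comp_id_r in A1, A2.
split.
- apply (peifferActs_of_cover (b := idm _) (a := r) ri rr).
  rewrite comp_id_l, comp_id_r. exact A1.
- apply (peifferActs_of_cover (b := r) (a := idm _) rr ri).
  rewrite comp_id_l, comp_id_r. exact A2.
Qed.

(** The morphism of graphs induced by [f] has the same kernel as [f], because it
    preserves domains. *)
Lemma kernel_normal (G : ReflGraph B) (k : px_ob X ~> rg_ob G) :
  IsNormalization k ->
  exists (D : C) (g : rg_ob G ~> D), IsKernel SA (k ∘ px_hom (px_kerm f)) g.
Proof.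
intros Hk. destruct (normalization_of_px Y) as [H [l Hl]].
destruct (normalization_desc f Hk Hl) as [F [[_ [Fd _]] Fk]].
exists (rg_ob H), F. apply IsKernel_intro.
- intros T x y exy. apply (kerm_mono (SA:=SA) (f := px_hom f)).
  apply (IsKernel_mono (normalization_kernel Hk)). rewrite !comp_assoc. exact exy.
- rewrite comp_assoc, Fk, <- comp_assoc. simpl. rewrite kerm_zero. apply comp_zmor.
- intros T t et.
  destruct (IsKernel_lift (normalization_kernel Hk) (t := t)) as [u eu].
  { rewrite <- Fd, <- comp_assoc, et. apply comp_zmor. }
  destruct (IsKernel_lift (kerm_isKernel SA (px_hom f)) (t := u)) as [v ev].
  { apply (IsKernel_mono (normalization_kernel Hl)).
    rewrite comp_assoc, <- Fk, <- comp_assoc, eu, et, comp_zmor. reflexivity. }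
  exists v. rewrite <- comp_assoc. simpl. rewrite ev. exact eu.
Qed.

(** The product [K × X] with the map [(k, x) ↦ k x] is the kernel pair of [f]:
    both are points over [X] with kernel [K]. *)
Lemma times_kernel_pair (K : PXMod SA B) (k : K ~> X) (mu : times K X ~> X) :
  IsKernel SA (px_hom k) (px_hom f) ->
  px_hom mu ∘ incl1 K X = px_hom k ->
  px_hom mu ∘ incl2 K X = idm (px_ob X) ->
  IsPullback f f (times_snd K X) mu.
Proof.
intros Hk m1 m2. apply px_isPullback.
change (px_hom (times_snd K X)) with (tsnd K X). set (p2 := tsnd K X).
assert (m2' : p2 ∘ incl2 K X = idm (px_ob X)) by apply tsnd_pair.
assert (E : px_hom f ∘ p2 = px_hom f ∘ px_hom mu).
{ apply (jointlyExtremal_epi SA (incl_jointlyExtremal (K := K) (X := X)));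
    rewrite <- !comp_assoc.
  - rewrite m1, (proj1 Hk). unfold p2, incl1. rewrite tsnd_pair. apply comp_zmor.
  - rewrite m2, m2'. reflexivity. }
pose (R := pullback SA (px_hom f) (px_hom f)).
destruct (IsPullback_lift (pb_isPullback R) E) as [h [h1 h2]].
assert (HR : IsKernel SA (h ∘ incl1 K X) (pb_fst R)).
{ apply (pullback_kernel (pb_isPullback R) Hk); rewrite comp_assoc.
  - rewrite h1. apply tsnd_pair.
  - rewrite h2. exact m1. }
assert (ih : IsIso h).
{ apply (@point_iso _ SA _ _ _ _ p2 (incl2 K X) (pb_fst R) (h ∘ incl2 K X) h
    (incl1 K X)).
  - exact m2'.
  - rewrite comp_assoc, h1. exact m2'.
  - exact h1.
  - reflexivity.
  - apply incl1_kernel.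
  - exact HR. }
destruct ih as [h' [hh' h'h]]. split; [exact E |].
intros T x y exy. destruct (IsPullback_lift (pb_isPullback R) exy) as [u [u1 u2]].
exists (h' ∘ u). split.
- rewrite <- h1, <- h2, <- !comp_assoc, !(comp_assoc h), h'h, comp_id_l.
  split; assumption.
- intros v [v1 v2]. rewrite <- (comp_id_l v), <- hh', <- comp_assoc. f_equal.
  apply (pb_ext (P:=R)); rewrite comp_assoc, ?h1, ?h2.
  + rewrite v1. exact u1.
  + rewrite v2. exact u2.
Qed.

(** [f] is trivialized by pulling it back along itself: the pullback is the
    projection from [K × X] to [X], and the reflection only affects [X]. *)
Lemma central_of_semidirects (K : PXMod SA B) (k : K ~> X)
    (S : PXSemidirect X K) (psi : sd_ob S ~> X) :
  IsRegularEpi f -> IsKernel SA (px_hom k) (px_hom f) ->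
  psi ∘ sd_j S = idm X -> psi ∘ sd_i S = k -> PeifferActs (idm X) k ->
  IsCentralExtension f.
Proof.
intros rf Hk psi1 psi2 A2.
assert (mk := IsKernel_mono Hk).
assert (hK : px_bd K = zmor SA K B).
{ rewrite <- (px_hom_bd k), <- (px_hom_bd f), <- comp_assoc, (proj1 Hk).
  apply comp_zmor. }
destruct (times_of_semidirect S hK) as [t [tj [ti it]]].
destruct it as [s [st ts]].
destruct (@px_hom_of_mono _ SA B _ _ _ t (idm (times K X)) s
  (mono_of_iso (ex_intro _ s (conj st ts))) ts) as [s' es].
subst s. pose (mu := psi ∘ s').
assert (m1 : px_hom mu ∘ incl1 K X = px_hom k).
{ unfold mu. rewrite <- ti, px_hom_comp, <- comp_assoc, (comp_assoc (px_hom s')), st.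
  rewrite comp_id_l, <- px_hom_comp, psi2. reflexivity. }
assert (m2 : px_hom mu ∘ incl2 K X = idm (px_ob X)).
{ unfold mu. rewrite <- tj, px_hom_comp, <- comp_assoc, (comp_assoc (px_hom s')), st.
  rewrite comp_id_l, <- px_hom_comp, psi1. reflexivity. }
(* Conjugation of [X] on [K] is trivial, because [K] and [X] commute through [mu].
   So [K] is abelian, and by the Peiffer condition [∂ X] acts trivially on [K]. *)
assert (I : forall (V W : C) (v : V ~> X) (w : W ~> K),
  copair SA v (px_hom k ∘ w) ∘ flat_ker SA V W =
  px_hom k ∘ (copair SA (zmor SA V K) w ∘ flat_ker SA V W)).
{ intros V W v w.
  transitivity (px_hom mu ∘
    (copair SA (incl2 K X ∘ v) (incl1 K X ∘ w) ∘ flat_ker SA V W)).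
  - rewrite comp_assoc, comp_copair, !comp_assoc, m1, m2, comp_id_l. reflexivity.
  - rewrite <- m1, <- !comp_assoc. f_equal. unfold incl1, incl2.
    apply times_ext; rewrite !comp_assoc, !comp_copair, !comp_assoc.
    + rewrite !tfst_pair, zmor_comp, !comp_id_l. reflexivity.
    + rewrite !tsnd_pair, !zmor_comp, !copair_zmor_flat_ker. reflexivity. }
assert (HK : conj_action SA K =
  copair SA (zmor SA K K) (idm (px_ob K)) ∘ flat_ker SA K K).
{ apply mk. rewrite <- (I _ _ (px_hom k)). unfold conj_action.
  rewrite comp_assoc, comp_copair, comp_id_r. reflexivity. }
assert (HXK : pullback_action (px_bd X) (px_act K) =
  copair SA (zmor SA X K) (idm (px_ob K)) ∘ flat_ker SA X K).
{ apply mk. rewrite <- (I _ _ (idm (px_ob X))), comp_id_r. exact A2. }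
destruct (reflection_exists UA X) as [GX [eta [Heta reta]]].
assert (HGK : pullback_action (px_bd GX) (px_act K) =
  copair SA (zmor SA GX K) (idm (px_ob K)) ∘ flat_ker SA GX K).
{ apply (regularEpi_epi (flat_map_regular_fst SA K reta)).
  rewrite <- comp_assoc, copair_flat_map, zmor_comp, comp_id_l, <- HXK.
  unfold pullback_action. rewrite <- comp_assoc, <- flat_map_comp, px_hom_bd.
  rewrite comp_id_l. reflexivity. }
assert (Hc := times_crossed (proj1 Heta) HK HGK).
destruct (times_map_exists K eta) as [G [G1 G2]].
exists X, f. split; [exact rf |].
exists (times K X), (times_snd K X), mu.
split; [exact (times_kernel_pair Hk m1 m2) |].
split.
- destruct (times_incl2 K X) as [i ei].
  apply (regularEpi_of_section (s := i)). apply PXHom_eq. simpl. rewrite ei.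
  apply tsnd_pair.
- exists (times K GX), GX, G, eta, (times_snd K GX).
  split; [exact (times_reflection Heta reta Hc G1 G2) |].
  split; [exact Heta |].
  apply px_isPullback. exact (times_map_pullback G1 G2).
Qed.

Lemma central_of_commutatorIsZero : IsRegularEpi f ->
  PeifferCommutatorIsZero (px_kerm f) (idm X) -> IsCentralExtension f.
Proof.
intros rf H0.
destruct (semidirects_of_commutatorIsZero H0) as [[S [h [h1 h2]]] [S' [h' [h1' h2']]]].
exact (central_of_semidirects (k := px_kerm f) rf (kerm_isKernel SA (px_hom f))
  h1' h2' (peifferActs_of_semidirect h1 h2)).
Qed.

Lemma commutatorIsZero_of_central :
  IsCentralExtension f -> PeifferCommutatorIsZero (px_kerm f) (idm X).
Proof.
intros H. destruct (peifferActs_of_central H) as [H1 H2].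
apply commutatorIsZero_of_graphActs; apply (graphActs_of_peifferActs UA).
- exact kernel_normal.
- exact H2.
- intros G k Hk. exists B, (rg_d G). rewrite px_hom_id, comp_id_r.
  exact (normalization_kernel Hk).
- exact H1.
Qed.

End Central.

Theorem theorem2p6 (C : Category) (SA : SemiAbelian C) (UA : ConditionUA SA)
    (B : C) (X Y : PXMod SA B) (f : X ~> Y) (f_extension : IsRegularEpi f) :
  IsCentralExtension f <->
  PeifferCommutatorIsZero (px_kerm f) (idm X).
Proof.
split.
- exact (commutatorIsZero_of_central UA (f := f)).
- exact (central_of_commutatorIsZero UA f_extension).
Qed.
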